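(* Let $\mathcal{B}=(\mathcal{B},\mathbb{E},\mathfrak{s})$ be a weakly idempotent complete extriangulated category, let $\mathcal{X}$ and $\mathcal{Y}$ be full additive subcategories of $\mathcal{B}$ which are closed under direct summands and isomorphisms, and put $\omega=\mathcal{X}\cap\mathcal{Y}$. Define three classes of morphisms of $\mathcal{B}$: $\mathrm{CoFib}_\omega=\{f: A\to B\mid f$ is an inflation with $\mathrm{Cone}(f)\in\mathcal{X}\}$; $\mathrm{Fib}_\omega=\{f: A\to B\mid \mathcal{B}(W,f):\mathcal{B}(W,A)\to\mathcal{B}(W,B)$ is surjective for every $W\in\omega\}$; $\mathrm{Weq}_\omega=\{f: A\to B\mid$ there is a deflation $(f,t): A\oplus W\to B$ with $W\in\omega$ and $\mathrm{CoCone}(f,t)\in\mathcal{Y}\}$. Then $(\mathrm{CoFib}_\omega,\mathrm{Fib}_\omega,\mathrm{Weq}_\omega)$ is a model structure on $\mathcal{B}$ if and only if $(\mathcal{X},\mathcal{Y})$ is a hereditary complete cotorsion pair in $\mathcal{B}$ and $\omega$ is contravariantly finite in $\mathcal{B}$. If this is the case, then the class $\mathrm{TCoFib}_\omega=\mathrm{CoFib}_\omega\cap\mathrm{Weq}_\omega$ of trivial cofibrations equals $\{f: A\to B\mid f$ is a splitting inflation with $\mathrm{Cone}(f)\in\omega\}$; the class $\mathrm{TFib}_\omega=\mathrm{Fib}_\omega\cap\mathrm{Weq}_\omega$ of trivial fibrations equals $\{f: A\to B\mid f$ is a deflation with $\mathrm{CoCone}(f)\in\mathcal{Y}\}$; the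 class of cofibrant objects is $\mathcal{X}$, the class of fibrant objects is $\mathcal{B}$, the class of trivial objects is $\mathcal{Y}$; and the homotopy category $\mathrm{Ho}(\mathcal{B})$ is equivalent to the additive quotient $\mathcal{X}/\omega$.
   Context: Extriangulated category (Nakaoka–Palu): a triple $(\mathcal{B},\mathbb{E},\mathfrak{s})$ with $\mathcal{B}$ an additive category, $\mathbb{E}:\mathcal{B}^{op}\times\mathcal{B}\to\mathrm{Ab}$ an additive bifunctor (write $a_*\delta=\mathbb{E}(C,a)(\delta)$, $c^*\delta=\mathbb{E}(c,A)(\delta)$ for $\delta\in\mathbb{E}(C,A)$; a morphism $\delta\to\delta'$ is a pair $(a,c)$ with $a_*\delta=c^*\delta'$), and $\mathfrak{s}$ assigning to each $\delta\in\mathbb{E}(C,A)$ an equivalence class $[A\to B\to C]$ of sequences (two sequences are equivalent if they are related by an isomorphism of middle terms compatible with identities on the ends), such that: (ET2) every morphism $(a,c):\delta\to\delta'$ is completed by some $b$ to a commutative morphism $(a,b,c)$ of realizing sequences, $\mathfrak{s}(0)=[A\to A\oplus C\to C]$, and $\mathfrak{s}(\delta\oplus\delta')=\mathfrak{s}(\delta)\oplus\mathfrak{s}(\delta')$; (ET3) if $A\xrightarrow{x}B\xrightarrow{y}C$ realizes $\delta$, $A'\xrightarrow{x'}B'\xrightarrow{y'}C'$ realizes $\delta'$ and $bx=x'a$, then there is $c$ with $cy=y'b$ and $a_*\delta=c^*\delta'$; (ET3)$^{op}$ the dual; (ET4) if $A\xrightarrow{f}B\xrightarrow{f'}D$ realizes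 $\delta$ and $B\xrightarrow{g}C\xrightarrow{g'}F$ realizes $\delta'$, then there are an object $E$, morphisms $d:D\to E$, $e:E\to F$, $h'\colon C\to E$ with $h'g=df'$, $eh'=g'$, and $\delta''\in\mathbb{E}(E,A)$ realized by $A\xrightarrow{gf}C\xrightarrow{h'}E$, such that $D\xrightarrow{d}E\xrightarrow{e}F$ realizes $f'_*\delta'$, $d^*\delta''=\delta$, $f_*\delta''=e^*\delta'$; (ET4)$^{op}$ the dual. A conflation is a sequence $A\xrightarrow{x}B\xrightarrow{y}C$ realizing some $\delta\in\mathbb{E}(C,A)$; with $\delta$ it is an $\mathbb{E}$-triangle; $x$ is an inflation, $y$ a deflation, $\mathrm{Cone}(x)=C$, $\mathrm{CoCone}(y)=A$. A splitting inflation is an inflation that is a section. $\mathcal{B}$ is weakly idempotent complete if every retraction has a kernel (equivalently every section has a cokernel). Cotorsion pair: $\mathcal{X}^\perp=\mathcal{Y}$ and ${}^\perp\mathcal{Y}=\mathcal{X}$, where $\mathcal{X}^\perp=\{Z\mid\mathbb{E}(X,Z)=0\ \forall X\in\mathcal{X}\}$, ${}^\perp\mathcal{Y}=\{Z\mid\mathbb{E}(Z,Y)=0\ \forall Y\in\mathcal{Y}\}$. It is complete if each $C\in\mathcal{B}$ admits conflations $Y_C\to X_C\to C$ and $C\to Y^C\to X^C$ with $X_C,X^C\in\mathcal{X}$, $Y_C,Y^C\in\mathcal{Y}$; it is hereditary if for every conflation $A\to B\to C$: $B,C\in\mathcal{X}$ implies $A\in\mathcal{X}$, and $A,B\in\mathcal{Y}$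 implies $C\in\mathcal{Y}$. $\omega$ is contravariantly finite in $\mathcal{B}$ if every $B\in\mathcal{B}$ has a right $\omega$-approximation, i.e. a morphism $t:W\to B$ with $W\in\omega$ through which every morphism $W'\to B$ with $W'\in\omega$ factors. Model structure on a category: a triple $(\mathrm{CoFib},\mathrm{Fib},\mathrm{Weq})$ of classes of morphisms satisfying the two-out-of-three axiom for $\mathrm{Weq}$; closure of each class under retracts; lifting ($\mathrm{CoFib}$ has the left lifting property against $\mathrm{Fib}\cap\mathrm{Weq}$, and $\mathrm{CoFib}\cap\mathrm{Weq}$ against $\mathrm{Fib}$); factorization (each morphism is $pi$ with $i\in\mathrm{CoFib}\cap\mathrm{Weq}$, $p\in\mathrm{Fib}$, and $qj$ with $j\in\mathrm{CoFib}$, $q\in\mathrm{Fib}\cap\mathrm{Weq}$). No existence of limits or colimits is required. $X$ is cofibrant if $0\to X\in\mathrm{CoFib}$, fibrant if $X\to0\in\mathrm{Fib}$, trivial if $0\to X\in\mathrm{Weq}$. $\mathrm{Ho}(\mathcal{B})=\mathcal{B}[\mathrm{Weq}^{-1}]$ is the localization. The quotient $\mathcal{X}/\omega$ has the objects of $\mathcal{X}$ and morphism groups $\mathrm{Hom}(X,X')$ modulo the morphisms factoring through an object of $\omega$. *)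

(* Defs.v *)
From HB Require Import structures.
From mathcomp Require Import all_boot all_algebra.
From mathcomp Require Import boolp.

Set Implicit Arguments.
Unset Strict Implicit.
Unset Printing Implicit Defensive.
#[local] Obligation Tactic := idtac.

Import GRing.Theory.
Local Open Scope quotient_scope.
Local Open Scope ring_scope.

Reserved Notation "g ∘ f" (at level 40, left associativity).
Reserved Notation "A ⊕ B" (at level 50, left associativity).

Record category := Category {
  obj :> Type;
  hom : obj -> obj -> Type;
  idm : forall A, hom A A;
  comp : forall A B C, hom B C -> hom A B -> hom A C;
  comp1m : forall A B (f : hom A B), comp (idm B) f = f;
  compm1 : forall A B (f : hom A B), comp f (idm A) = f;
  compA : forall A B C D (h : hom C D) (g : hom B C) (f : hom A B),
    comp h (comp g f) = comp (comp h g) f }.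

Arguments idm {_} _.
Arguments comp {_ _ _ _} _ _.
Notation "g ∘ f" := (comp g f).

Definition is_iso (C : category) (A B : C) (f : hom A B) : Prop :=
  exists g : hom B A, g ∘ f = idm A /\ f ∘ g = idm B.

Definition isomorphic (C : category) (A B : C) : Prop :=
  exists f : hom A B, is_iso f.

Definition is_section (C : category) (A B : C) (f : hom A B) : Prop :=
  exists r : hom B A, r ∘ f = idm A.

Definition is_retraction (C : category) (A B : C) (f : hom A B) : Prop :=
  exists s : hom B A, f ∘ s = idm B.

Record functor (C D : category) := Functor {
  fobj :> C -> D;
  fmap : forall A B : C, hom A B -> hom (fobj A) (fobj B);
  fmap1 : forall A : C, fmap (idm A) = idm (fobj A);
  fmapM : forall (A B E : C) (g : hom B E) (f : hom A B),
    fmap (g ∘ f) = fmap g ∘ fmap f }.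

Definition id_functor (C : category) : functor C C :=
  @Functor C C (fun A => A) (fun _ _ f => f)
    (fun _ => erefl) (fun _ _ _ _ _ => erefl).

Program Definition comp_functor (C D E : category)
    (G : functor D E) (F : functor C D) : functor C E :=
  @Functor C E (fun A => G (F A)) (fun _ _ f => fmap G (fmap F f)) _ _.
Next Obligation. by move=> C D E G F A /=; rewrite !fmap1. Qed.
Next Obligation. by move=> C D E G F * /=; rewrite !fmapM. Qed.

Definition naturally_isomorphic (C D : category) (F G : functor C D) : Prop :=
  exists eta : forall A : C, hom (F A) (G A),
    (forall A, is_iso (eta A)) /\
    (forall (A B : C) (f : hom A B), eta B ∘ fmap F f = fmap G f ∘ eta A).

Definition equivalent_categories (C D : category) : Prop :=
  exists (F : functor C D) (G : functor D C),
    naturally_isomorphic (comp_functor G F) (id_functor C) /\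
    naturally_isomorphic (comp_functor F G) (id_functor D).

Definition morphism_class (C : category) := forall A B : C, hom A B -> Prop.

Definition meet_class (C : category) (P Q : morphism_class C) :
  morphism_class C := fun A B f => P A B f /\ Q A B f.

Definition is_retract (C : category) (A B A' B' : C)
    (f : hom A B) (g : hom A' B') : Prop :=
  exists (i : hom A A') (r : hom A' A) (j : hom B B') (s : hom B' B),
    [/\ r ∘ i = idm A, s ∘ j = idm B, g ∘ i = j ∘ f & f ∘ r = s ∘ g].

Definition closed_under_retracts (C : category) (P : morphism_class C) : Prop :=
  forall (A B A' B' : C) (f : hom A B) (g : hom A' B'),
    is_retract f g -> P _ _ g -> P _ _ f.

Definition two_out_of_three (C : category) (W : morphism_class C) : Prop :=
  forall (A B D : C) (f : hom A B) (g : hom B D),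
    [/\ W _ _ f -> W _ _ g -> W _ _ (g ∘ f),
        W _ _ f -> W _ _ (g ∘ f) -> W _ _ g
      & W _ _ g -> W _ _ (g ∘ f) -> W _ _ f].

Definition lifts (C : category) (L R : morphism_class C) : Prop :=
  forall (A B D E : C) (i : hom A B) (p : hom D E) (u : hom A D) (v : hom B E),
    L _ _ i -> R _ _ p -> p ∘ u = v ∘ i ->
    exists h : hom B D, h ∘ i = u /\ p ∘ h = v.

Definition factorizes (C : category) (L R : morphism_class C) : Prop :=
  forall (A B : C) (f : hom A B),
    exists (D : C) (i : hom A D) (p : hom D B),
      [/\ L _ _ i, R _ _ p & f = p ∘ i].

Record is_model_structure (C : category) (CoFib Fib Weq : morphism_class C) :
    Prop := IsModelStructure {
  ms_two_out_of_three : two_out_of_three Weq;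
  ms_retract_cofib : closed_under_retracts CoFib;
  ms_retract_fib : closed_under_retracts Fib;
  ms_retract_weq : closed_under_retracts Weq;
  ms_lift_cofib : lifts CoFib (meet_class Fib Weq);
  ms_lift_fib : lifts (meet_class CoFib Weq) Fib;
  ms_factor_tcofib : factorizes (meet_class CoFib Weq) Fib;
  ms_factor_tfib : factorizes CoFib (meet_class Fib Weq) }.

(* The Gabriel-Zisman construction: same objects, and as morphisms the
   zigzags of morphisms of C and formal inverses of morphisms of W, modulo the
   relations of C and those making the formal inverses two-sided inverses. *)
Section Localization.
Variables (C : category) (W : morphism_class C).

Inductive zigzag (A : C) : C -> Type :=
| znil : zigzag A A
| zfwd (D E : C) (p : zigzag A D) (f : hom D E) : zigzag A E
| zbwd (D E : C) (p : zigzag A D) (w : hom E D) (Ww : W w) : zigzag A E.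

Inductive zeq (A : C) : forall D : C, zigzag A D -> zigzag A D -> Prop :=
| zeq_refl D (p : zigzag A D) : zeq p p
| zeq_sym D (p q : zigzag A D) : zeq p q -> zeq q p
| zeq_trans D (p q r : zigzag A D) : zeq p q -> zeq q r -> zeq p r
| zeq_fwd D E (p q : zigzag A D) (f : hom D E) :
    zeq p q -> zeq (zfwd p f) (zfwd q f)
| zeq_bwd D E (p q : zigzag A D) (w : hom E D) (Ww : W w) :
    zeq p q -> zeq (zbwd p Ww) (zbwd q Ww)
| zeq_id D (p : zigzag A D) : zeq (zfwd p (idm D)) p
| zeq_comp D E F (p : zigzag A D) (f : hom D E) (g : hom E F) :
    zeq (zfwd (zfwd p f) g) (zfwd p (g ∘ f))
| zeq_fb D E (p : zigzag A D) (w : hom D E) (Ww : W w) :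
    zeq (zbwd (zfwd p w) Ww) p
| zeq_bf D E (p : zigzag A D) (w : hom E D) (Ww : W w) :
    zeq (zfwd (zbwd p Ww) w) p.

Fixpoint zcat (A B D : C) (p : zigzag A B) (q : zigzag B D) : zigzag A D :=
  match q with
  | znil => p
  | zfwd _ _ q' f => zfwd (zcat p q') f
  | zbwd _ _ q' _ Ww => zbwd (zcat p q') Ww
  end.

Lemma zcat0z A B (q : zigzag A B) : zcat (znil A) q = q.
Proof. by elim: q => //= [D E q -> | D E q -> w Ww]. Qed.

Lemma zcatA A B D E (p : zigzag A B) (q : zigzag B D) (r : zigzag D E) :
  zcat p (zcat q r) = zcat (zcat p q) r.
Proof. by elim: r => //= [F G r -> | F G r -> w Ww]. Qed.

Lemma zeq_cat A B D (p p' : zigzag A B) (q q' : zigzag B D) :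
  zeq p p' -> zeq q q' -> zeq (zcat p q) (zcat p' q').
Proof.
move=> pp' qq'; apply: (@zeq_trans _ _ _ (zcat p' q)).
  elim: q {q' qq'} => //= [E F q IH f | E F q IH w Ww]; first exact: zeq_fwd.
  exact: zeq_bwd.
elim: qq' => /=; by [constructor | move=> *; apply: zeq_sym
  | move=> E a b c _ ab _ bc; apply: zeq_trans ab bc].
Qed.

Definition zeqb (A B : C) : rel {classic (zigzag A B)} :=
  fun p q => `[< zeq (p : zigzag A B) q >].

Lemma zeqb_equiv A B : equiv_class_of (@zeqb A B).
Proof.
split=> [p | p q | q p r].
- by apply/asboolP; exact: zeq_refl.
- by apply: asbool_equiv_eq; split; exact: zeq_sym.
- by move=> /asboolP pq /asboolP qr; apply/asboolP; exact: zeq_trans pq qr.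
Qed.

Canonical zeqb_equiv_rel A B := EquivRelPack (zeqb_equiv A B).

Definition loc_hom (A B : C) := {eq_quot (@zeqb_equiv_rel A B)}.

Definition loc_class (A B : C) (p : zigzag A B) : loc_hom A B :=
  \pi_(loc_hom A B) (p : {classic (zigzag A B)}).

Definition loc_repr (A B : C) (u : loc_hom A B) : zigzag A B := repr u.

Lemma loc_reprK A B (u : loc_hom A B) : loc_class (loc_repr u) = u.
Proof. exact: reprK. Qed.

Lemma loc_classP A B (p q : zigzag A B) :
  loc_class p = loc_class q <-> zeq p q.
Proof.
split=> [/eqmodP /asboolP // | pq].
by apply/eqmodP/asboolP.
Qed.

Definition loc_comp (A B D : C) (v : loc_hom B D) (u : loc_hom A B) :
  loc_hom A D := loc_class (zcat (loc_repr u) (loc_repr v)).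

Lemma loc_compE A B D (q : zigzag B D) (p : zigzag A B) :
  loc_comp (loc_class q) (loc_class p) = loc_class (zcat p q).
Proof. by apply/loc_classP/zeq_cat; apply/loc_classP; rewrite loc_reprK. Qed.

Program Definition localization : category :=
  @Category C loc_hom (fun A => loc_class (znil A)) loc_comp _ _ _.
Next Obligation. by move=> A B u; rewrite -(loc_reprK u) loc_compE. Qed.
Next Obligation. by move=> A B u; rewrite -(loc_reprK u) loc_compE zcat0z. Qed.
Next Obligation.
move=> A B D E w v u.
by rewrite -(loc_reprK u) -(loc_reprK v) -(loc_reprK w) !loc_compE zcatA.
Qed.

End Localization.

Record hom_group_category := HomGroupCategory {
  hg_category :> category;
  hg_zmod : forall A B : hg_category, GRing.Zmodule (hom A B) }.

HB.instance Definition _ (C : hom_group_category) (A B : C) :=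
  @hg_zmod C A B.

Record biproduct (C : hom_group_category) (A B : C) := Biproduct {
  bip_obj :> C;
  bip_in1 : hom A bip_obj;
  bip_in2 : hom B bip_obj;
  bip_pr1 : hom bip_obj A;
  bip_pr2 : hom bip_obj B;
  bip_pr1in1 : bip_pr1 ∘ bip_in1 = idm A;
  bip_pr2in2 : bip_pr2 ∘ bip_in2 = idm B;
  bip_pr1in2 : bip_pr1 ∘ bip_in2 = 0;
  bip_pr2in1 : bip_pr2 ∘ bip_in1 = 0;
  bip_sum : bip_in1 ∘ bip_pr1 + bip_in2 ∘ bip_pr2 = idm bip_obj }.

Record additive_category := AdditiveCategory {
  add_hom_group :> hom_group_category;
  compDm : forall (A B D : add_hom_group) (g g' : hom B D) (f : hom A B),
    (g + g') ∘ f = g ∘ f + g' ∘ f;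
  compmD : forall (A B D : add_hom_group) (g : hom B D) (f f' : hom A B),
    g ∘ (f + f') = g ∘ f + g ∘ f';
  zero_obj : add_hom_group;
  zero_objP : idm zero_obj = 0;
  bip : forall A B : add_hom_group, biproduct A B }.

Arguments zero_obj {_}.
Notation "A ⊕ B" := (bip_obj (bip A B)).

Section AdditiveConstructions.
Variable C : additive_category.

Definition in1 (A B : C) : hom A (A ⊕ B) := bip_in1 (bip A B).
Definition in2 (A B : C) : hom B (A ⊕ B) := bip_in2 (bip A B).
Definition pr1 (A B : C) : hom (A ⊕ B) A := bip_pr1 (bip A B).
Definition pr2 (A B : C) : hom (A ⊕ B) B := bip_pr2 (bip A B).

Definition copair (A B D : C) (f : hom A D) (g : hom B D) : hom (A ⊕ B) D :=
  f ∘ pr1 A B + g ∘ pr2 A B.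

Definition dsum_hom (A B A' B' : C) (f : hom A B) (f' : hom A' B') :
  hom (A ⊕ A') (B ⊕ B') :=
  in1 B B' ∘ f ∘ pr1 A A' + in2 B B' ∘ f' ∘ pr2 A A'.

Definition is_kernel (A B K : C) (f : hom A B) (k : hom K A) : Prop :=
  f ∘ k = 0 /\
  forall (T : C) (t : hom T A), f ∘ t = 0 -> exists! u : hom T K, k ∘ u = t.

Definition weakly_idempotent_complete : Prop :=
  forall (A B : C) (r : hom A B), is_retraction r ->
    exists (K : C) (k : hom K A), is_kernel r k.

End AdditiveConstructions.

(* Closure under the second summand follows from closure under isomorphisms,
   as A ⊕ B and B ⊕ A are isomorphic. *)
Record add_subcategory (C : additive_category) := AddSubcategory {
  in_subcat :> C -> Prop;
  subcat_zero : in_subcat zero_obj;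
  subcat_dsum : forall A B : C,
    in_subcat A -> in_subcat B -> in_subcat (A ⊕ B);
  subcat_summand : forall A B : C, in_subcat (A ⊕ B) -> in_subcat A;
  subcat_iso : forall A B : C, isomorphic A B -> in_subcat A -> in_subcat B }.

Program Definition meet_subcategory (C : additive_category)
    (X Y : add_subcategory C) : add_subcategory C :=
  @AddSubcategory C (fun A => X A /\ Y A) _ _ _ _.
Next Obligation. by move=> C X Y; split; exact: subcat_zero. Qed.
Next Obligation.
by move=> C X Y A B [XA YA] [XB YB]; split; exact: subcat_dsum.
Qed.
Next Obligation.
by move=> C X Y A B [XAB YAB]; split;
  [exact: subcat_summand XAB | exact: subcat_summand YAB].
Qed.
Next Obligation.
by move=> C X Y A B AB [XA YA]; split;
  [exact: subcat_iso AB XA | exact: subcat_iso AB YA].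
Qed.

Section Quotient.
Variables (C : additive_category) (X om : add_subcategory C).

Definition factors_through (A B : C) (f : hom A B) : Prop :=
  exists (V : C) (g : hom A V) (h : hom V B), om V /\ f = h ∘ g.

Lemma comp0m (A B D : C) (f : hom A B) : (0 : hom B D) ∘ f = 0.
Proof. by apply: (addrI (0 ∘ f)); rewrite -compDm !addr0. Qed.

Lemma compm0 (A B D : C) (g : hom B D) : g ∘ (0 : hom A B) = 0.
Proof. by apply: (addrI (g ∘ 0)); rewrite -compmD !addr0. Qed.

Lemma compNm (A B D : C) (g : hom B D) (f : hom A B) : (- g) ∘ f = - (g ∘ f).
Proof. by apply: (addrI (g ∘ f)); rewrite -compDm !subrr comp0m. Qed.

Lemma compmN (A B D : C) (g : hom B D) (f : hom A B) : g ∘ (- f) = - (g ∘ f).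
Proof. by apply: (addrI (g ∘ f)); rewrite -compmD !subrr compm0. Qed.

Lemma factors_through0 (A B : C) : factors_through (0 : hom A B).
Proof. by exists zero_obj, 0, 0; rewrite comp0m; split=> //; exact: subcat_zero. Qed.

Lemma factors_throughN (A B : C) (f : hom A B) :
  factors_through f -> factors_through (- f).
Proof. by move=> [V [g [h [oV ->]]]]; exists V, g, (- h); rewrite compNm. Qed.

Lemma factors_throughD (A B : C) (f f' : hom A B) :
  factors_through f -> factors_through f' -> factors_through (f + f').
Proof.
move=> [V [g [h [oV ->]]]] [V' [g' [h' [oV' ->]]]].
exists (V ⊕ V'), (in1 V V' ∘ g + in2 V V' ∘ g'), (copair h h').
split; first exact: subcat_dsum.
rewrite /copair compmD !compDm !compA -!(compA h) -!(compA h').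
rewrite /in1 /in2 /pr1 /pr2 bip_pr1in1 bip_pr1in2 bip_pr2in1 bip_pr2in2.
by rewrite !comp0m !compm0 !comp1m addr0 add0r.
Qed.

Lemma factors_through_compl (A B D : C) (g : hom B D) (f : hom A B) :
  factors_through f -> factors_through (g ∘ f).
Proof. by move=> [V [a [b [oV ->]]]]; exists V, a, (g ∘ b); rewrite compA. Qed.

Lemma factors_through_compr (A B D : C) (g : hom B D) (f : hom A B) :
  factors_through g -> factors_through (g ∘ f).
Proof. by move=> [V [a [b [oV ->]]]]; exists V, (a ∘ f), b; rewrite compA. Qed.

Definition om_congr (A B : C) : rel (hom A B) :=
  fun f g => `[< factors_through (f - g) >].

Lemma om_congr_equiv (A B : C) : equiv_class_of (@om_congr A B).
Proof.
split=> [f | f g | g f h].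
- by apply/asboolP; rewrite subrr; exact: factors_through0.
- by apply: asbool_equiv_eq; split=> /factors_throughN; rewrite opprB.
- move=> /asboolP fg /asboolP gh; apply/asboolP.
  by rewrite -(subrKA g); exact: factors_throughD.
Qed.

Canonical om_congr_equiv_rel (A B : C) := EquivRelPack (om_congr_equiv A B).

Definition quo_obj : Type := {A : C | X A}.

Definition quo_hom (A B : quo_obj) : Type :=
  {eq_quot (@om_congr_equiv_rel (sval A) (sval B))}.

Definition quo_class (A B : quo_obj) (f : hom (sval A) (sval B)) :
  quo_hom A B := \pi_{eq_quot (@om_congr_equiv_rel (sval A) (sval B))} f.

Definition quo_repr (A B : quo_obj) (u : quo_hom A B) :
  hom (sval A) (sval B) := repr u.

Lemma quo_reprK (A B : quo_obj) (u : quo_hom A B) : quo_class (quo_repr u) = u.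
Proof. exact: reprK. Qed.

Lemma quo_classP (A B : quo_obj) (f g : hom (sval A) (sval B)) :
  @quo_class A B f = @quo_class A B g <-> factors_through (f - g).
Proof. by split=> [/eqmodP /asboolP // | fg]; apply/eqmodP/asboolP. Qed.

Definition quo_comp (A B D : quo_obj) (v : quo_hom B D) (u : quo_hom A B) :
  quo_hom A D := @quo_class A D (quo_repr v ∘ quo_repr u).

Lemma quo_compE (A B D : quo_obj)
    (g : hom (sval B) (sval D)) (f : hom (sval A) (sval B)) :
  quo_comp (@quo_class B D g) (@quo_class A B f) = @quo_class A D (g ∘ f).
Proof.
apply/quo_classP; set g' := quo_repr _; set f' := quo_repr _.
have gg : factors_through (g' - g) by apply/quo_classP; rewrite quo_reprK.
have ff : factors_through (f' - f) by apply/quo_classP; rewrite quo_reprK.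
have -> : g' ∘ f' - g ∘ f = (g' - g) ∘ f' + g ∘ (f' - f).
  by rewrite compDm compmD compNm compmN subrKA.
by apply: factors_throughD; [exact: factors_through_compr
  | exact: factors_through_compl].
Qed.

Program Definition quotient_category : category :=
  @Category quo_obj quo_hom (fun A => @quo_class A A (idm (sval A)))
    quo_comp _ _ _.
Next Obligation. by move=> A B u; rewrite -(quo_reprK u) quo_compE comp1m. Qed.
Next Obligation. by move=> A B u; rewrite -(quo_reprK u) quo_compE compm1. Qed.
Next Obligation.
move=> A B D E w v u.
by rewrite -(quo_reprK u) -(quo_reprK v) -(quo_reprK w) !quo_compE compA.
Qed.

End Quotient.

(* [ext D A] is the group E(D, A), contravariant in D and covariant in A;
   [push a] is a_* and [pull c] is c^*. *)
Record ext_bifunctor (C : additive_category) := ExtBifunctor {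
  ext : C -> C -> zmodType;
  push : forall D A A' : C, hom A A' -> {additive ext D A -> ext D A'};
  pull : forall A D D' : C, hom D' D -> {additive ext D A -> ext D' A};
  push1 : forall (D A : C) (d : ext D A), push D (idm A) d = d;
  pushM : forall (D A A' A'' : C) (a' : hom A' A'') (a : hom A A')
    (d : ext D A), push D (a' ∘ a) d = push D a' (push D a d);
  pull1 : forall (D A : C) (d : ext D A), pull A (idm D) d = d;
  pullM : forall (A D D' D'' : C) (c : hom D' D) (c' : hom D'' D')
    (d : ext D A), pull A (c ∘ c') d = pull A c' (pull A c d);
  push_pull : forall (A A' D D' : C) (a : hom A A') (c : hom D' D)
    (d : ext D A), push D' a (pull A c d) = pull A' c (push D a d);
  push_add : forall (D A A' : C) (a a' : hom A A') (d : ext D A),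
    push D (a + a') d = push D a d + push D a' d;
  pull_add : forall (A D D' : C) (c c' : hom D' D) (d : ext D A),
    pull A (c + c') d = pull A c d + pull A c' d }.

Arguments ext {_ _} _ _.
Arguments push {_ _ _ _ _} _.
Arguments pull {_ _ _ _ _} _.

Definition ext_dsum (C : additive_category) (E : ext_bifunctor C)
    (A A' D D' : C) (d : @ext C E D A) (d' : @ext C E D' A') :
  @ext C E (D ⊕ D') (A ⊕ A') :=
  push (in1 A A') (pull (pr1 D D') d) + push (in2 A A') (pull (pr2 D D') d').

Definition equivalent_sequences (C : category) (A D B B' : C)
    (x : hom A B) (y : hom B D) (x' : hom A B') (y' : hom B' D) : Prop :=
  exists b : hom B B', [/\ is_iso b, b ∘ x = x' & y' ∘ b = y].

(* The class s(d) is given by its members: [realizes d x y] means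
   s(d) = [A --x--> B --y--> D]. *)
Record extriangulated_category := ExtriangulatedCategory {
  et_additive :> additive_category;
  et_ext :> ext_bifunctor et_additive;
  realizes : forall A B D : et_additive,
    @ext _ et_ext D A -> hom A B -> hom B D -> Prop;
  realizes_ex : forall (A D : et_additive) (d : @ext _ et_ext D A),
    exists (B : et_additive) (x : hom A B) (y : hom B D), realizes d x y;
  realizes_class : forall (A D B B' : et_additive) (d : @ext _ et_ext D A)
    (x : hom A B) (y : hom B D) (x' : hom A B') (y' : hom B' D),
    realizes d x y ->
    (realizes d x' y' <-> equivalent_sequences x y x' y');
  ET2_morphism : forall (A B D A' B' D' : et_additive)
    (d : @ext _ et_ext D A) (x : hom A B) (y : hom B D)
    (d' : @ext _ et_ext D' A') (x' : hom A' B') (y' : hom B' D')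
    (a : hom A A') (c : hom D D'),
    realizes d x y -> realizes d' x' y' -> push a d = pull c d' ->
    exists b : hom B B', b ∘ x = x' ∘ a /\ c ∘ y = y' ∘ b;
  ET2_zero : forall A D : et_additive,
    realizes (0 : @ext _ et_ext D A) (in1 A D) (pr2 A D);
  ET2_dsum : forall (A B D A' B' D' : et_additive)
    (d : @ext _ et_ext D A) (x : hom A B) (y : hom B D)
    (d' : @ext _ et_ext D' A') (x' : hom A' B') (y' : hom B' D'),
    realizes d x y -> realizes d' x' y' ->
    realizes (ext_dsum d d') (dsum_hom x x') (dsum_hom y y');
  ET3 : forall (A B D A' B' D' : et_additive)
    (d : @ext _ et_ext D A) (x : hom A B) (y : hom B D)
    (d' : @ext _ et_ext D' A') (x' : hom A' B') (y' : hom B' D')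
    (a : hom A A') (b : hom B B'),
    realizes d x y -> realizes d' x' y' -> b ∘ x = x' ∘ a ->
    exists c : hom D D', c ∘ y = y' ∘ b /\ push a d = pull c d';
  ET3op : forall (A B D A' B' D' : et_additive)
    (d : @ext _ et_ext D A) (x : hom A B) (y : hom B D)
    (d' : @ext _ et_ext D' A') (x' : hom A' B') (y' : hom B' D')
    (b : hom B B') (c : hom D D'),
    realizes d x y -> realizes d' x' y' -> c ∘ y = y' ∘ b ->
    exists a : hom A A', b ∘ x = x' ∘ a /\ push a d = pull c d';
  ET4 : forall (A B D G F : et_additive)
    (d : @ext _ et_ext D A) (f : hom A B) (f' : hom B D)
    (d' : @ext _ et_ext F B) (g : hom B G) (g' : hom G F),
    realizes d f f' -> realizes d' g g' ->
    exists (E : et_additive) (u : hom D E) (e : hom E F) (h' : hom G E)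
      (d'' : @ext _ et_ext E A),
      [/\ h' ∘ g = u ∘ f' /\ e ∘ h' = g',
          realizes d'' (g ∘ f) h',
          realizes (push f' d') u e,
          pull u d'' = d
        & push f d'' = pull e d'];
  ET4op : forall (A B D G F : et_additive)
    (d : @ext _ et_ext A D) (f' : hom D B) (f : hom B A)
    (d' : @ext _ et_ext B F) (g' : hom F G) (g : hom G B),
    realizes d f' f -> realizes d' g' g ->
    exists (E : et_additive) (u : hom E D) (e : hom F E) (h' : hom E G)
      (d'' : @ext _ et_ext A E),
      [/\ g ∘ h' = f' ∘ u /\ h' ∘ e = g',
          realizes d'' h' (f ∘ g),
          realizes (pull f' d') e u,
          push u d'' = d
        & pull f d'' = push e d'] }.

Section Extriangulated.
Variable C : extriangulated_category.

Definition conflation (A B D : C) (x : hom A B) (y : hom B D) : Prop :=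
  exists d : @ext _ C D A, realizes d x y.

Definition inflation (A B : C) (x : hom A B) : Prop :=
  exists (D : C) (y : hom B D), conflation x y.

Definition deflation (B D : C) (y : hom B D) : Prop :=
  exists (A : C) (x : hom A B), conflation x y.

Definition splitting_inflation (A B : C) (x : hom A B) : Prop :=
  inflation x /\ is_section x.

(* Cones and cocones are only determined up to isomorphism; the classes P
   used below are closed under isomorphisms. *)
Definition cone_in (P : C -> Prop) (A B : C) (x : hom A B) : Prop :=
  exists (D : C) (y : hom B D), conflation x y /\ P D.

Definition cocone_in (P : C -> Prop) (B D : C) (y : hom B D) : Prop :=
  exists (A : C) (x : hom A B), conflation x y /\ P A.

Definition right_perp (X : C -> Prop) (Z : C) : Prop :=
  forall A : C, X A -> forall d : @ext _ C A Z, d = 0.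

Definition left_perp (Y : C -> Prop) (Z : C) : Prop :=
  forall A : C, Y A -> forall d : @ext _ C Z A, d = 0.

Definition cotorsion_pair (X Y : C -> Prop) : Prop :=
  (forall Z : C, right_perp X Z <-> Y Z) /\
  (forall Z : C, left_perp Y Z <-> X Z).

Definition complete_pair (X Y : C -> Prop) : Prop :=
  forall A : C,
    (exists (Y0 X0 : C) (i : hom Y0 X0) (p : hom X0 A),
        [/\ conflation i p, X X0 & Y Y0]) /\
    (exists (Y1 X1 : C) (i : hom A Y1) (p : hom Y1 X1),
        [/\ conflation i p, X X1 & Y Y1]).

Definition hereditary_pair (X Y : C -> Prop) : Prop :=
  forall (A B D : C) (x : hom A B) (y : hom B D), conflation x y ->
    (X B -> X D -> X A) /\ (Y A -> Y B -> Y D).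

Definition hereditary_complete_cotorsion_pair (X Y : C -> Prop) : Prop :=
  [/\ cotorsion_pair X Y, complete_pair X Y & hereditary_pair X Y].

Definition contravariantly_finite (om : C -> Prop) : Prop :=
  forall B : C, exists (V : C) (t : hom V B), om V /\
    forall (V' : C) (s : hom V' B), om V' ->
      exists u : hom V' V, s = t ∘ u.

Variables X Y : add_subcategory C.

Definition omega : add_subcategory C := meet_subcategory X Y.

Definition CoFib_omega : morphism_class C := fun A B f =>
  inflation f /\ cone_in X f.

Definition Fib_omega : morphism_class C := fun A B f =>
  forall V : C, omega V ->
    forall s : hom V B, exists u : hom V A, f ∘ u = s.

Definition Weq_omega : morphism_class C := fun A B f =>
  exists (V : C) (t : hom V B),
    [/\ omega V, deflation (copair f t) & cocone_in Y (copair f t)].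

Definition cofibrant (CoFib : morphism_class C) (A : C) : Prop :=
  CoFib zero_obj A 0.

Definition fibrant (Fib : morphism_class C) (A : C) : Prop :=
  Fib A zero_obj 0.

Definition trivial_obj (Weq : morphism_class C) (A : C) : Prop :=
  Weq zero_obj A 0.

End Extriangulated.

(* Main.v *)
(** A morphism is a weak equivalence exactly when it induces bijections
    [Hom(X0, A) / omega -> Hom(X0, B) / omega] for all [X0] in X; this makes
    two-out-of-three and closure under retracts formal.  For the nontrivial
    implication, replace [f] by [(f, t)] with [t] a right omega-approximation:
    every morphism from X to the codomain now lifts, so it is a deflation by
    weak idempotent completeness, and its cocone [K] satisfies E(X, K) = 0
    because a class in E(X0, K) comes from some X' -> K with
    X' -> XM -> X0 a conflation in X (hereditarity), and X' -> K -> A is zero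
    modulo omega, hence extends to XM.  Conversely, in a model structure every
    object of Y is trivially fibrant; this forces E(X, Y) = 0, and the
    factorizations of the morphisms to and from 0 are the approximation
    sequences.  The homotopy category is computed by the cofibrant
    replacements, the deflations onto A from X with cocone in Y. *)
From HB Require Import structures.
From mathcomp Require Import all_boot all_algebra.
From mathcomp Require Import boolp.
Require Import Defs.

Set Implicit Arguments.
Unset Strict Implicit.
Unset Printing Implicit Defensive.
#[local] Obligation Tactic := idtac.

Import GRing.Theory.
Local Open Scope ring_scope.

Section Isomorphisms.
Variable C : category.

(** The inverse of [g ∘ f] yields a left inverse of [f], that of [f ∘ g] a right inverse, and the
    two must agree. *)
Lemma is_iso_of_comps (A B : C) (f : hom A B) (g : hom B A) :
  is_iso (g ∘ f) -> is_iso (f ∘ g) -> is_iso f.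
Proof.
move=> [l [lgf _]] [r [_ fgr]]; exists (g ∘ r); split; last by rewrite compA.
have <- : l ∘ g = g ∘ r by rewrite -[LHS]compm1 -fgr !compA -(compA l) lgf comp1m.
by rewrite -compA.
Qed.

End Isomorphisms.

(** * Matrix calculus and complements of retracts in an additive category *)

Section Additive.
Variable C : additive_category.
Implicit Types A B D : C.

Definition pair A B D (f : hom D A) (g : hom D B) : hom D (A ⊕ B) :=
  in1 A B ∘ f + in2 A B ∘ g.

Lemma pr1_in1 A B : pr1 A B ∘ in1 A B = idm A. Proof. exact: bip_pr1in1. Qed.
Lemma pr2_in2 A B : pr2 A B ∘ in2 A B = idm B. Proof. exact: bip_pr2in2. Qed.
Lemma pr1_in2 A B : pr1 A B ∘ in2 A B = 0. Proof. exact: bip_pr1in2. Qed.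
Lemma pr2_in1 A B : pr2 A B ∘ in1 A B = 0. Proof. exact: bip_pr2in1. Qed.

Lemma copair_in1 A B D (f : hom A D) (g : hom B D) : copair f g ∘ in1 A B = f.
Proof. by rewrite compDm -!compA pr1_in1 pr2_in1 compm0 compm1 addr0. Qed.

Lemma copair_in2 A B D (f : hom A D) (g : hom B D) : copair f g ∘ in2 A B = g.
Proof. by rewrite compDm -!compA pr1_in2 pr2_in2 compm0 compm1 add0r. Qed.

Lemma pr1_pair A B D (f : hom D A) (g : hom D B) : pr1 A B ∘ pair f g = f.
Proof. by rewrite compmD !compA pr1_in1 pr1_in2 comp0m comp1m addr0. Qed.

Lemma pr2_pair A B D (f : hom D A) (g : hom D B) : pr2 A B ∘ pair f g = g.
Proof. by rewrite compmD !compA pr2_in1 pr2_in2 comp0m comp1m add0r. Qed.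

Lemma copair_pair A B D T (f : hom A D) (g : hom B D) (a : hom T A)
  (b : hom T B) : copair f g ∘ pair a b = f ∘ a + g ∘ b.
Proof. by rewrite compmD !compA copair_in1 copair_in2. Qed.

Lemma comp_copair A B D T (h : hom D T) (f : hom A D) (g : hom B D) :
  h ∘ copair f g = copair (h ∘ f) (h ∘ g).
Proof. by rewrite compmD !compA. Qed.

Lemma pair_comp A B D T (f : hom D A) (g : hom D B) (h : hom T D) :
  pair f g ∘ h = pair (f ∘ h) (g ∘ h).
Proof. by rewrite compDm -!compA. Qed.

Lemma pair_pr A B D (f : hom D (A ⊕ B)) : f = pair (pr1 A B ∘ f) (pr2 A B ∘ f).
Proof. by rewrite /pair !compA -compDm bip_sum comp1m. Qed.

Lemma copair_in A B D (f : hom (A ⊕ B) D) :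
  f = copair (f ∘ in1 A B) (f ∘ in2 A B).
Proof. by rewrite /copair -!compA -compmD bip_sum compm1. Qed.

Lemma pair_ext A B D (f g : hom D (A ⊕ B)) :
  pr1 A B ∘ f = pr1 A B ∘ g -> pr2 A B ∘ f = pr2 A B ∘ g -> f = g.
Proof. by move=> e1 e2; rewrite (pair_pr f) (pair_pr g) e1 e2. Qed.

Lemma copair_ext A B D (f g : hom (A ⊕ B) D) :
  f ∘ in1 A B = g ∘ in1 A B -> f ∘ in2 A B = g ∘ in2 A B -> f = g.
Proof. by move=> e1 e2; rewrite (copair_in f) (copair_in g) e1 e2. Qed.

Lemma hom_to_zero A (f : hom A zero_obj) : f = 0.
Proof. by rewrite -[f]comp1m zero_objP comp0m. Qed.

Lemma hom_from_zero A (f : hom zero_obj A) : f = 0.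
Proof. by rewrite -[f]compm1 zero_objP compm0. Qed.

(** With [n = idm A - c] of square zero, the inverse of [c = idm A - n] is [idm A + n]. *)
Lemma unipotent_iso A (c : hom A A) :
  (idm A - c) ∘ (idm A - c) = 0 -> is_iso c.
Proof.
have := erefl (idm A - c); move: {2 3 4}(idm A - c) => n ec nn.
have {ec} -> : c = idm A - n by rewrite -ec opprB addrC subrK.
exists (idm A + n); rewrite !(compDm, compmD, compNm, compmN) nn.
by rewrite !(comp1m, compm1, oppr0) !addr0 subrK addrK.
Qed.

(** Here [k] is the kernel of [r], and [q] is the factorization through it of the idempotent
    [idm B - s ∘ r]; the identities on [q ∘ k] and [q ∘ s] follow by cancelling the monomorphism
    [k]. *)
Lemma retract_complement (wic : weakly_idempotent_complete C) A B
    (s : hom A B) (r : hom B A) : r ∘ s = idm A ->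
  exists (K : C) (k : hom K B) (q : hom B K),
    [/\ q ∘ k = idm K, r ∘ k = 0, q ∘ s = 0 & s ∘ r + k ∘ q = idm B].
Proof.
move=> rs; have [K [k [rk kerk]]] : exists K k, @is_kernel C B A K r k.
  by apply: wic; exists s.
have inj T (u v : hom T K) : k ∘ u = k ∘ v -> u = v.
  move=> e; have [|w [_ uw]] := kerk _ (k ∘ u).
    by rewrite compA rk comp0m.
  by rewrite -(uw u) // (uw v).
have [|q [kq _]] := kerk _ (idm B - s ∘ r).
  by rewrite compmD compmN compm1 compA rs comp1m subrr.
exists K, k, q; split=> //.
- by apply: inj; rewrite compA kq compDm compNm -compA rk compm0 comp1m compm1 subr0.
- by apply: inj; rewrite compA kq compDm compNm -compA rs comp1m compm0 compm1 subrr.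
by rewrite kq addrC subrK.
Qed.

Lemma complement_iso A B K (s : hom A B) (r : hom B A) (k : hom K B)
    (q : hom B K) :
  r ∘ s = idm A -> q ∘ k = idm K -> r ∘ k = 0 -> q ∘ s = 0 ->
  s ∘ r + k ∘ q = idm B -> is_iso (copair s k).
Proof.
move=> rs qk rk qs sum; exists (pair r q); rewrite copair_pair sum; split=> //.
by apply: copair_ext; rewrite -compA !(copair_in1, copair_in2) comp1m pair_comp
  !(rs, qk, rk, qs) /pair !(compm0, compm1) ?addr0 ?add0r.
Qed.

(** Weak idempotent completeness turns the retract into a direct summand, to which closure under
    summands applies. *)
Lemma subcat_retract (wic : weakly_idempotent_complete C)
    (P : add_subcategory C) A B (s : hom A B) (r : hom B A) :
  r ∘ s = idm A -> P B -> P A.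
Proof.
move=> rs PB; have [K [k [q [qk rk qs sum]]]] := retract_complement wic rs.
have [t [h1 h2]] := complement_iso rs qk rk qs sum.
apply: (@subcat_summand _ P A K); apply: subcat_iso PB.
by exists t, (copair s k).
Qed.

End Additive.

(** * Duality *)

Section Opposite.

Definition op_category (C : category) : category :=
  @Category C (fun A B => hom B A) (fun A => idm A) (fun _ _ _ g f => f ∘ g)
    (fun _ _ f => compm1 f) (fun _ _ f => comp1m f)
    (fun _ _ _ _ h g f => esym (compA f g h)).

Definition op_hom_group (C : hom_group_category) : hom_group_category :=
  @HomGroupCategory (op_category C) (fun A B => @hg_zmod C B A).

Definition op_biproduct (C : additive_category) (A B : C) :
    @biproduct (op_hom_group C) A B :=
  @Biproduct (op_hom_group C) A B (A ⊕ B) (pr1 A B) (pr2 A B) (in1 A B)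
    (in2 A B) (pr1_in1 A B) (pr2_in2 A B) (pr2_in1 A B) (pr1_in2 A B)
    (bip_sum (bip A B)).

Definition op_additive (C : additive_category) : additive_category :=
  @AdditiveCategory (op_hom_group C) (fun _ _ _ g g' f => compmD f g g')
    (fun _ _ _ g f f' => compDm f f' g) zero_obj (zero_objP C)
    (@op_biproduct C).

Program Definition op_ext (C : additive_category) (E : ext_bifunctor C) :
    ext_bifunctor (op_additive C) :=
  @ExtBifunctor (op_additive C) (fun D A => @ext C E A D)
    (fun D _ _ a => @pull C E D _ _ a) (fun A _ _ c => @push C E A _ _ c)
    _ _ _ _ _ _ _.
Next Obligation. by move=> C E D A d; exact: pull1. Qed.
Next Obligation. by move=> C E D A A' A'' a' a d; exact: pullM. Qed.
Next Obligation. by move=> C E D A d; exact: push1. Qed.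
Next Obligation. by move=> C E A D D' D'' c c' d; exact: pushM. Qed.
Next Obligation. by move=> C E A A' D D' a c d; rewrite push_pull. Qed.
Next Obligation. by move=> C E D A A' a a' d; exact: pull_add. Qed.
Next Obligation. by move=> C E A D D' c c' d; exact: push_add. Qed.

Lemma op_is_iso (C : category) (A B : C) (f : hom A B) :
  is_iso f <-> @is_iso (op_category C) B A f.
Proof. by split=> -[g [h1 h2]]; exists g. Qed.

Lemma op_equivalent_sequences (C : category) (A D B B' : C)
    (x : hom A B) (y : hom B D) (x' : hom A B') (y' : hom B' D) :
  equivalent_sequences x y x' y' <->
  @equivalent_sequences (op_category C) D A B B' y x y' x'.
Proof.
split=> -[b [[b' [b'b bb']] bx y'b]]; exists b'.
  split; [by exists b | by rewrite /= -y'b -compA bb' compm1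
    | by rewrite /= -bx compA b'b comp1m].
rewrite /= in b' b'b bb' bx y'b *.
by split; [exists b | rewrite -y'b compA bb' comp1m | rewrite -bx -compA b'b compm1].
Qed.

(** The data are those of [C] with arguments exchanged, and [ET3], [ET4] trade places with their
    duals. Statements over the opposite thus unfold to dual statements over [C], and results on
    deflations become results on inflations by conversion. *)
Program Definition op_extriangulated (C : extriangulated_category) :
    extriangulated_category :=
  @ExtriangulatedCategory (op_additive C) (op_ext C)
    (fun A B D d x y => @realizes C D B A d y x) _ _ _ _ _ _ _ _ _.
Next Obligation.
move=> C A D d; have [B [x [y r]]] := realizes_ex d.
by exists B, y, x.
Qed.
Next Obligation.
move=> C A D B B' d x y x' y' r; apply: (iff_trans (realizes_class y' x' r)).
exact: op_equivalent_sequences.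
Qed.
Next Obligation.
move=> C A B D A' B' D' d x y d' x' y' a c r r' e.
by have [b [h1 h2]] := ET2_morphism r' r (esym e); exists b.
Qed.
Next Obligation.
move=> C; change (forall A D : C,
  realizes (0 : @ext C C A D) (in2 A D) (pr1 A D)) => A D.
(* Exchanging the summands identifies the split sequence on [D ⊕ A] with the one on [A ⊕ D]. *)
apply: (iffRL (realizes_class (in2 A D) (pr1 A D) (ET2_zero D A))).
exists (pair (pr2 D A) (pr1 D A)); split; first 1 last.
- by rewrite pair_comp pr2_in1 pr1_in1 /pair compm0 compm1 add0r.
- by rewrite pr1_pair.
by exists (pair (pr2 A D) (pr1 A D)); split; apply: pair_ext;
  rewrite compA !(pr1_pair, pr2_pair) compm1.
Qed.
Next Obligation.
move=> C A B D A' B' D' d x y d' x' y' r r'.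
move: (ET2_dsum r r'); rewrite /ext_dsum /dsum_hom /= -!push_pull -!compA.
exact.
Qed.
Next Obligation.
move=> C A B D A' B' D' d x y d' x' y' a b r r' e.
by have [c [h1 h2]] := ET3op r' r (esym e); exists c.
Qed.
Next Obligation.
move=> C A B D A' B' D' d x y d' x' y' b c r r' e.
by have [a [h1 h2]] := ET3 r' r (esym e); exists a.
Qed.
Next Obligation.
move=> C A B D G F d f f' d' g g' r r'.
have [E [u [e [h' [d'' [[h1 h2] h3 h4 h5 h6]]]]]] := ET4op r r'.
by exists E, u, e, h', d''.
Qed.
Next Obligation.
move=> C A B D G F d f' f d' g' g r r'.
have [E [u [e [h' [d'' [[h1 h2] h3 h4 h5 h6]]]]]] := ET4 r r'.
by exists E, u, e, h', d''.
Qed.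

End Opposite.

(** * Long exact sequences *)

Section Exactness.
Variable C : extriangulated_category.
Implicit Types A B D T : C.

Lemma realizes_isoM A B B' D (d : @ext C C D A) (x : hom A B) (y : hom B D)
    (b : hom B B') (b' : hom B' B) :
  b' ∘ b = idm B -> b ∘ b' = idm B' ->
  realizes d x y -> realizes d (b ∘ x) (y ∘ b').
Proof.
move=> b'b bb' r; apply: (iffRL (realizes_class _ _ r)).
by exists b; split=> //; [exists b' | rewrite -compA b'b compm1].
Qed.

Lemma realizes0_id A : realizes (0 : @ext C C A zero_obj) 0 (idm A).
Proof.
apply: (iffRL (realizes_class _ _ (ET2_zero zero_obj A))).
exists (pr2 zero_obj A); split; rewrite ?pr2_in1 ?comp1m //.
exists (in2 zero_obj A); split; last exact: pr2_in2.
by apply: pair_ext; [rewrite [LHS]hom_to_zero [RHS]hom_to_zero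
  | rewrite compA pr2_in2 comp1m compm1].
Qed.

Section Triangle.
Variables (A B D : C) (d : @ext C C D A) (x : hom A B) (y : hom B D).
Hypothesis r : realizes d x y.

(** This lemma and the next three compare the triangle with a split one having a zero end term. Here
    the target is [0 -> 0 ⊕ D -> D], so [in2 ∘ y ∘ x] factors through the zero object. *)
Lemma realizes_comp0 : y ∘ x = 0.
Proof.
have [|a [e _]] := ET3op (b := in2 zero_obj D ∘ y) (c := idm D) r
  (ET2_zero zero_obj D).
  by rewrite compA pr2_in2.
have := congr1 (comp (pr2 zero_obj D)) e.
by rewrite !compA pr2_in2 pr2_in1 comp1m comp0m.
Qed.

Lemma realizes_pull0 : pull y d = 0.
Proof.
have [|a [_ e]] := ET3op (b := pr2 zero_obj B) (c := y)
  (ET2_zero zero_obj B) r => //.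
by rewrite -e raddf0.
Qed.

Lemma lift_ker T (t : hom T B) : y ∘ t = 0 -> exists s : hom T A, t = x ∘ s.
Proof.
move=> yt; have [|a [e _]] := ET3op (b := t ∘ pr1 T zero_obj) (c := 0)
  (ET2_zero T zero_obj) r.
  by rewrite comp0m compA yt comp0m.
by exists a; rewrite -e -compA pr1_in1 compm1.
Qed.

Lemma lift_of_pull0 T (c : hom T D) :
  pull c d = 0 -> exists s : hom T B, c = y ∘ s.
Proof.
move=> e; have [|b [_ h]] := ET2_morphism (a := 0 : hom zero_obj A) (c := c)
  (ET2_zero zero_obj T) r.
  by rewrite raddf0.
by exists (b ∘ in2 zero_obj T); rewrite compA -h -compA pr2_in2 compm1.
Qed.

End Triangle.

End Exactness.

Section DualExactness.
Variables (C : extriangulated_category) (A B D : C) (d : @ext C C D A).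
Variables (x : hom A B) (y : hom B D).
Hypothesis r : realizes d x y.
Let Cop := op_extriangulated C.

Lemma realizes_push0 : push x d = 0.
Proof. exact: (@realizes_pull0 Cop D B A d y x r). Qed.

Lemma factor_of_push0 T (a : hom A T) :
  push a d = 0 -> exists s : hom B T, a = s ∘ x.
Proof. exact: (@lift_of_pull0 Cop D B A d y x r). Qed.

End DualExactness.

Section ExtExactness.
Variable C : extriangulated_category.
Implicit Types A B D T : C.
Variables (A B D : C) (d : @ext C C D A).
Variables (x : hom A B) (y : hom B D).
Hypothesis r : realizes d x y.

(** If [x] kills [e], it extends along the inflation of a realization of [e]; [ET3] over the
    identity of [A] then gives the morphism on cones. *)
Lemma ext_ker_push T (e : @ext C C T A) :
  push x e = 0 -> exists c : hom T D, e = pull c d.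
Proof.
have [M [i [p re]]] := realizes_ex e.
move=> /(factor_of_push0 re) [s es].
have [|c [_ ec]] := ET3 (a := idm A) (b := s) re r; first by rewrite compm1.
by exists c; rewrite -ec push1.
Qed.

(* Pulling [e] back along [x] splits the kernel [E] of the composite deflation
   onto [D], and a retraction of [T -> E] transports [e] to a pullback. *)
Lemma ext_ker_pull_infl T (e : @ext C C B T) :
  pull x e = 0 -> exists e' : @ext C C D T, e = pull y e'.
Proof.
move=> xe; have [M [i [p re]]] := realizes_ex e.
have [E [u [t [h [d'' [_ _ rt _ pe]]]]]] := ET4op r re.
have [|s st] := factor_of_push0 rt (a := idm T); first by rewrite push1 xe.
by exists (push s d''); rewrite -push_pull pe -pushM -st push1.
Qed.

(** The difference [idm D - c] pulls [d] back to zero, so it factors through [y]; as it also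
    annihilates [y], its square is zero. *)
Lemma cone_endo_iso (c : hom D D) : c ∘ y = y -> pull c d = d -> is_iso c.
Proof.
move=> cy cd; apply: unipotent_iso.
have [|s {2}->] := lift_of_pull0 r (c := idm D - c).
  have := pull_add (idm D - c) c d; rewrite subrK pull1 cd => /esym.
  by move/(canRL (addrK d)); rewrite subrr.
by rewrite compA compDm compNm comp1m cy subrr comp0m.
Qed.

(** [ET3] over [idm A] gives comparison maps both ways between the cones. Their composite on [D] is
    an isomorphism by [cone_endo_iso], and its inverse corrects the second map. *)
Lemma cone_retract B' D' (d' : @ext C C D' A) (x' : hom A B')
    (y' : hom B' D') (b : hom B B') (b' : hom B' B) :
  realizes d' x' y' -> b ∘ x = x' -> b' ∘ x' = x -> b' ∘ b = idm B ->
  exists (c : hom D D') (c' : hom D' D), c' ∘ c = idm D.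
Proof.
move=> r' bx b'x' b'b.
have [|c [cy cd]] := ET3 (a := idm A) (b := b) r r'; first by rewrite compm1.
have [|c' [c'y c'd]] := ET3 (a := idm A) (b := b') r' r; first by rewrite compm1.
rewrite !push1 in cd c'd.
have [||k [kc _]] := @cone_endo_iso (c' ∘ c).
- by rewrite -compA cy compA c'y -compA b'b compm1.
- by rewrite pullM -c'd -cd.
by exists c, (k ∘ c'); rewrite -compA.
Qed.

End ExtExactness.

Lemma cone_iso (C : extriangulated_category) (A B D D' : C)
    (x : hom A B) (y : hom B D) (y' : hom B D') :
  conflation x y -> conflation x y' ->
  exists c : hom D D', is_iso c /\ c ∘ y = y'.
Proof.
move=> [d r] [d' r'].
have [|c [cy cd]] := ET3 (a := idm A) (b := idm B) r r'.
  by rewrite compm1 comp1m.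
have [|c' [c'y c'd]] := ET3 (a := idm A) (b := idm B) r' r.
  by rewrite compm1 comp1m.
rewrite !push1 !compm1 in cd c'd cy c'y.
exists c; split=> //; apply: (is_iso_of_comps (g := c')).
  by apply: (cone_endo_iso r); rewrite ?pullM -?c'd // -compA cy c'y.
by apply: (cone_endo_iso r'); rewrite ?pullM -?cd // -compA c'y cy.
Qed.

Section DualExtExactness.
Variables (C : extriangulated_category) (A B D : C) (d : @ext C C D A).
Variables (x : hom A B) (y : hom B D).
Hypothesis r : realizes d x y.
Let Cop := op_extriangulated C.

Lemma ext_ker_push_defl T (e : @ext C C T B) :
  push y e = 0 -> exists e' : @ext C C T A, e = push x e'.
Proof. exact: (@ext_ker_pull_infl Cop D B A d y x r). Qed.

End DualExtExactness.

(** * Weak idempotent completeness *)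

Section Conflations.
Variable C : extriangulated_category.
Implicit Types A B D T : C.

Lemma conflation_isoM A B B' D (x : hom A B) (y : hom B D) (b : hom B B')
    (b' : hom B' B) :
  b' ∘ b = idm B -> b ∘ b' = idm B' ->
  conflation x y -> conflation (b ∘ x) (y ∘ b').
Proof. by move=> h1 h2 [d r]; exists d; exact: realizes_isoM. Qed.

Lemma conflation_in1_pr2 A B : conflation (in1 A B) (pr2 A B).
Proof. by exists 0; exact: ET2_zero. Qed.

Lemma realizes0_in2_pr1 A B : realizes (0 : @ext C C A B) (in2 A B) (pr1 A B).
Proof. exact: (@ET2_zero (op_extriangulated C) A B). Qed.

Lemma conflation_in2_pr1 A B : conflation (in2 A B) (pr1 A B).
Proof. by exists 0; exact: realizes0_in2_pr1. Qed.

Lemma conflation_zero_id A : conflation (0 : hom zero_obj A) (idm A).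
Proof. by exists 0; exact: realizes0_id. Qed.

Lemma conflation_id_zero A : conflation (idm A) (0 : hom A zero_obj).
Proof. by exists 0; exact: (@realizes0_id (op_extriangulated C) A). Qed.

Lemma conflation_split A B K (s : hom A B) (r : hom B A) (k : hom K B)
    (q : hom B K) :
  r ∘ s = idm A -> q ∘ k = idm K -> r ∘ k = 0 -> q ∘ s = 0 ->
  s ∘ r + k ∘ q = idm B -> conflation s q.
Proof.
move=> rs qk rk qs sum; have [t [h1 h2]] := complement_iso rs qk rk qs sum.
have := conflation_isoM h1 h2 (conflation_in1_pr2 A K).
rewrite copair_in1; have <- // : q = pr2 A K ∘ t.
have e : q ∘ copair s k = pr2 A K.
  by rewrite comp_copair qs qk /copair comp0m comp1m add0r.
by rewrite -e -compA h2 compm1.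
Qed.

Lemma conflation_comp A B D K M (x : hom A B) (y : hom B D) (i : hom K M)
    (p : hom M B) :
  conflation x y -> conflation i p ->
  exists (E : C) (j : hom E M) (q : hom E A) (k : hom K E),
    [/\ conflation j (y ∘ p), conflation k q & p ∘ j = x ∘ q].
Proof.
move=> [d r] [d' r'].
have [E [q [k [j [d'' [[h1 h2] h3 h4 h5 h6]]]]]] := ET4op r r'.
by exists E, j, q, k; split=> //; [exists d'' | exists (pull x d')].
Qed.

Lemma deflation_comp B D M (y : hom B D) (p : hom M B) :
  deflation y -> deflation p -> deflation (y ∘ p).
Proof.
move=> [A [x c]] [K [i c']]; have [E [j [_ [_ [h _ _]]]]] := conflation_comp c c'.
by exists E, j.
Qed.

(** The morphism is the projection [pr1] preceded by a shear automorphism of [D ⊕ T]. *)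
Lemma deflation_copair1 D T (z : hom T D) : deflation (copair (idm D) z).
Proof.
have := @conflation_isoM _ _ _ _ _ _ (pair (pr1 D T - z ∘ pr2 D T) (pr2 D T))
  (pair (pr1 D T + z ∘ pr2 D T) (pr2 D T)) _ _ (conflation_in2_pr1 D T).
rewrite pr1_pair => h; exists T, (pair (pr1 D T - z ∘ pr2 D T) (pr2 D T) ∘ in2 D T).
rewrite /copair comp1m; apply: h.
  by apply: pair_ext; rewrite compA !(pr1_pair, pr2_pair) ?compDm -?compA
    ?(pr1_pair, pr2_pair) compm1 ?subrK.
by apply: pair_ext; rewrite compA !(pr1_pair, pr2_pair) ?compDm ?compNm -?compA
    ?(pr1_pair, pr2_pair) compm1 ?addrK.
Qed.

Lemma deflation_copair B D T (y : hom B D) (z : hom T D) :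
  deflation y -> deflation (copair y z).
Proof.
move=> [A [x [d r]]].
have -> : copair y z = copair (idm D) z ∘ dsum_hom y (idm T).
  by rewrite /dsum_hom compm1 compmD !compA copair_in1 copair_in2 comp1m.
apply: deflation_comp; first exact: deflation_copair1.
by do 2 eexists; eexists; exact: ET2_dsum r (realizes0_id T).
Qed.

Hypothesis wic : weakly_idempotent_complete C.

(** The summand [A] lies in the kernel of [g ∘ pr1], hence splits off [K] with complement [L]. [ET4]
    for [A -> K -> B ⊕ A] gives a conflation from [L] to [D] whose middle term is the cone of [in2],
    that is, [B]. The retraction onto [L] later keeps cocones inside [Y]. *)
Lemma conflation_cancel_pr1 A B D K (g : hom B D) (k : hom K (B ⊕ A)) :
  conflation k (g ∘ pr1 B A) ->
  exists (L : C) (l : hom L B) (s : hom L K) (r : hom K L),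
    conflation l g /\ r ∘ s = idm L.
Proof.
move=> [d rk].
have [|s ks] := lift_ker rk (t := in2 B A); first by rewrite -compA pr1_in2 compm0.
have rs : (pr2 B A ∘ k) ∘ s = idm A by rewrite -compA -ks pr2_in2.
have [L [i [q [qi ri qs sum]]]] := retract_complement wic rs.
have [d' r'] := conflation_split rs qi ri qs sum.
have [E [u [e [h [d'' [[_ eh] r'' rE _ _]]]]]] := ET4 r' rk.
have [|c [[c' [c'c cc']] cpr]] := @cone_iso _ _ _ _ _ _ _ h (conflation_in2_pr1 B A).
  by exists d''; rewrite ks.
exists L, (c' ∘ u), i, q; split=> //.
have <- : e ∘ c = g.
  by rewrite -[LHS]compm1 -(pr1_in1 B A) compA -(compA e) cpr eh -compA pr1_in1 compm1.
by apply: conflation_isoM => //; exists (push q d).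
Qed.

(** Adding a summand makes [(g ∘ f, g)] a deflation; the isomorphism [b] of its source with [B ⊕ A]
    turns it into [g ∘ pr1], from which [A] is cancelled. *)
Lemma deflation_cancel A B D (g : hom B D) (f : hom A B) :
  deflation (g ∘ f) -> deflation g.
Proof.
move=> /(@deflation_copair _ _ B _ g) [K [k cf]].
pose b := pair (f ∘ pr1 A B + pr2 A B) (pr1 A B).
pose b' := pair (pr2 B A) (pr1 B A - f ∘ pr2 B A).
have b'b : b' ∘ b = idm (A ⊕ B).
  by apply: pair_ext; rewrite compA !(pr1_pair, pr2_pair) ?compDm ?compNm -?compA
    ?(pr1_pair, pr2_pair) compm1 // addrC addKr.
have bb' : b ∘ b' = idm (B ⊕ A).
  by apply: pair_ext; rewrite compA !(pr1_pair, pr2_pair) ?compDm ?compNm -?compA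
    ?(pr1_pair, pr2_pair) compm1 // subrKC.
have e : copair (g ∘ f) g ∘ b' = g ∘ pr1 B A.
  by rewrite copair_pair compmD compmN (compA g) subrKC.
have := conflation_isoM b'b bb' cf; rewrite e => h.
by have [L [l [s [r [? _]]]]] := conflation_cancel_pr1 h; exists L, l.
Qed.

End Conflations.

Lemma op_wic (C : additive_category) :
  weakly_idempotent_complete C -> weakly_idempotent_complete (op_additive C).
Proof.
move=> wic; change (forall (A B : C) (s : hom B A), is_section s ->
  exists (K : C) (k : hom A K), @is_kernel (op_additive C) A B K s k).
move=> A B s [r rs].
have [K [k [q [qk rk qs sum]]]] := retract_complement wic rs.
have coker (T : C) (t : hom A T) : t ∘ s = 0 -> exists! u : hom K T, u ∘ q = t.
  move=> ts; exists (t ∘ k); split=> [|u <-]; last by rewrite -compA qk compm1.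
  by rewrite -[RHS]compm1 -sum compmD !compA ts comp0m add0r.
by exists K, q; split; [exact: qs | exact: coker].
Qed.

Section InflationCancel.
Variables (C : extriangulated_category) (wic : weakly_idempotent_complete C).

Lemma inflation_cancel (A B D : C) (g : hom B D) (f : hom A B) :
  inflation (g ∘ f) -> inflation f.
Proof. exact: (@deflation_cancel (op_extriangulated C) (op_wic wic) D B A f g). Qed.

End InflationCancel.

(** * Trivial cofibrations and trivial fibrations *)

Section OrthogonalPair.
Variables (C : extriangulated_category) (wic : weakly_idempotent_complete C).
Variables X Y : add_subcategory C.
Notation om := (omega X Y).
Implicit Types A B D : C.

Lemma cone_inP (P : add_subcategory C) A B D (x : hom A B) (y : hom B D) :
  conflation x y -> cone_in P x -> P D.
Proof.
move=> c [D' [y' [c' PD']]]; have [k [isok _]] := cone_iso c' c.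
by apply: subcat_iso PD'; exists k.
Qed.

Lemma iso_deflation A B (f : hom A B) :
  is_iso f -> exists z : hom zero_obj A, conflation z f.
Proof.
move=> [g [gf fg]]; exists (g ∘ 0).
by rewrite -[f]comp1m; apply: conflation_isoM => //; exact: conflation_zero_id.
Qed.

Lemma splitting_complement (P : add_subcategory C) A B (f : hom A B) :
  splitting_inflation f -> cone_in P f ->
  exists (K : C) (k : hom K B) (r : hom B A) (q : hom B K),
    [/\ P K, r ∘ f = idm A, q ∘ f = 0, f ∘ r + k ∘ q = idm B
      & is_iso (copair f k)].
Proof.
move=> [_ [r rf]] Pf; have [K [k [q [qk rk qf sum]]]] := retract_complement wic rf.
have cf := conflation_split rf qk rk qf sum.
exists K, k, r, q; split=> //; last exact: complement_iso sum.
exact: cone_inP cf Pf.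
Qed.

(** The complement of [f] serves as the auxiliary object: it makes [(f, k)] an isomorphism, a
    deflation with zero cocone. *)
Lemma weq_splitting A B (f : hom A B) :
  splitting_inflation f -> cone_in om f -> Weq_omega X Y f.
Proof.
move=> sf cf; have [K [k [_ [_ [omK _ _ _ ik]]]]] := splitting_complement sf cf.
have [z cz] := iso_deflation ik.
exists K, k; split=> //; exists zero_obj, z => //; split=> //.
exact: subcat_zero.
Qed.

Lemma weq_deflation A B (f : hom A B) : cocone_in Y f -> Weq_omega X Y f.
Proof.
move=> [K [k [ck YK]]]; exists zero_obj, 0.
have : conflation (in1 A zero_obj ∘ k) (f ∘ pr1 A zero_obj).
  apply: conflation_isoM ck; first exact: pr1_in1.
  apply: copair_ext; last by rewrite [LHS]hom_from_zero [RHS]hom_from_zero.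
  by rewrite -compA pr1_in1 compm1 comp1m.
have -> : copair f (0 : hom zero_obj B) = f ∘ pr1 A zero_obj.
  by rewrite /copair comp0m addr0.
move=> c; split; first exact: subcat_zero.
  by exists K, (in1 A zero_obj ∘ k).
by exists K, (in1 A zero_obj ∘ k).
Qed.

Hypothesis orth : forall A Z, X A -> Y Z -> forall d : @ext C C A Z, d = 0.

(** Both obstructions vanish because E(X0, Y0) = 0. The class [pull v e] dies on [A], so it comes
    from that group, and [v] lifts to some [h0]; the error [h0 ∘ i - u] lands in [Y0] and extends
    along [i], which corrects [h0]. *)
Lemma cofib_lift A B D F (i : hom A B) (p : hom D F) (u : hom A D)
    (v : hom B F) :
  cone_in X i -> cocone_in Y p -> p ∘ u = v ∘ i ->
  exists h : hom B D, h ∘ i = u /\ p ∘ h = v.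
Proof.
move=> [X0 [q [[d ri] XX0]]] [Y0 [k [[e rp] YY0]]] pu.
have [|h0 vh0] := lift_of_pull0 rp (c := v).
  have [|e' ->] := ext_ker_pull_infl ri (e := pull v e).
    by rewrite -pullM -pu pullM (realizes_pull0 rp) raddf0.
  by rewrite (orth XX0 YY0 e') raddf0.
have [|s us] := lift_ker rp (t := h0 ∘ i - u).
  by rewrite compmD compmN compA -vh0 pu subrr.
have [|s' ss'] := factor_of_push0 ri (a := s); first exact: orth.
exists (h0 - k ∘ s'); split.
  by rewrite compDm compNm -compA -ss' -us subKr.
by rewrite compmD compmN compA (realizes_comp0 rp) comp0m subr0.
Qed.

Lemma fib_deflation A B (f : hom A B) : cocone_in Y f -> Fib_omega X Y f.
Proof.
move=> [Y0 [k [[e rf] YY0]]] V [XV _] s.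
have [|u su] := lift_of_pull0 rf (c := s); first exact: orth.
by exists u.
Qed.

Lemma tcofibP A B (f : hom A B) :
  meet_class (CoFib_omega X) (Weq_omega X Y) f <->
  splitting_inflation f /\ cone_in om f.
Proof.
split=> [[[infl Xf] [V [t [omV _ Yft]]]]|[sf cf]]; last first.
  split; last exact: weq_splitting.
  by split; [case: sf | case: cf => D [y [c [XD _]]]; exists D, y].
(* Lifting [f] against [(f, t)] splits [f] and makes it a retract of [in1 A V] under [A]; its cone
   is then a retract of [V]. *)
have [|h [hf fh]] := cofib_lift (u := in1 A V) (v := idm B) Xf Yft.
  by rewrite copair_in1 comp1m.
have rf : (pr1 A V ∘ h) ∘ f = idm A by rewrite -compA hf pr1_in1.
have sf : splitting_inflation f by split=> //; exists (pr1 A V ∘ h).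
split=> //; have [D [y [c XD]]] := Xf; exists D, y; split=> //.
have [d ry] := c.
have [a [a' a'a]] := cone_retract ry (ET2_zero A V) hf
  (copair_in1 f t) fh.
exact: (subcat_retract wic (P := om) a'a).
Qed.

(** Since [t] lifts through [f], a shear of [A ⊕ V] turns [(f, t)] into [f ∘ pr1], and [V] can be
    cancelled. *)
Lemma fib_cocone A B (f : hom A B) :
  Fib_omega X Y f -> Weq_omega X Y f -> cocone_in Y f.
Proof.
move=> fibf [V [t [omV _ [K [k [c YK]]]]]].
have [u fu] := fibf V omV t.
pose b := pair (pr1 A V + u ∘ pr2 A V) (pr2 A V).
pose b' := pair (pr1 A V - u ∘ pr2 A V) (pr2 A V).
have b'b : b' ∘ b = idm (A ⊕ V).
  by apply: pair_ext; rewrite compA !(pr1_pair, pr2_pair) ?compDm ?compNm -?compA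
    ?(pr1_pair, pr2_pair) compm1 // addrK.
have bb' : b ∘ b' = idm (A ⊕ V).
  by apply: pair_ext; rewrite compA !(pr1_pair, pr2_pair) ?compDm ?compNm -?compA
    ?(pr1_pair, pr2_pair) compm1 // subrK.
have e : copair f t ∘ b' = f ∘ pr1 A V.
  by rewrite copair_pair compmD compmN compA fu subrK.
have := conflation_isoM b'b bb' c; rewrite e => h.
have [L [l [s [r [cl rs]]]]] := conflation_cancel_pr1 wic h.
by exists L, l; split=> //; exact: subcat_retract rs YK.
Qed.

Lemma tfibP A B (f : hom A B) :
  meet_class (Fib_omega X Y) (Weq_omega X Y) f <->
  deflation f /\ cocone_in Y f.
Proof.
split=> [[fibf wf]|[_ cf]]; last by split; [exact: fib_deflation | exact: weq_deflation].
have cf := fib_cocone fibf wf; split=> //.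
by case: cf => K [k [ck _]]; exists K, k.
Qed.

Lemma cofibrantP A : cofibrant (CoFib_omega X) A <-> X A.
Proof.
split=> [[_ c]|XA]; first exact: cone_inP (conflation_zero_id A) c.
by have c := conflation_zero_id A; split; exists A, (idm A).
Qed.

Lemma fibrant_omega A : fibrant (Fib_omega X Y) A.
Proof. by move=> V _ s; exists 0; rewrite [LHS]hom_to_zero [RHS]hom_to_zero. Qed.

Lemma trivial_of_Y A : Y A -> cocone_in Y (0 : hom A zero_obj).
Proof. by exists A, (idm A); split=> //; exact: conflation_id_zero. Qed.

End OrthogonalPair.

(** * From model structures to cotorsion pairs *)

Section ModelToCotorsion.
Variables (C : extriangulated_category) (wic : weakly_idempotent_complete C).
Variables X Y : add_subcategory C.
Notation om := (omega X Y).
Implicit Types A B D : C.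

Lemma cocone_inP (P : add_subcategory C) A B D (x : hom A B) (y : hom B D) :
  conflation x y -> cocone_in P y -> P A.
Proof.
move=> cxy [A' [x' [cx'y PA']]].
have [c [isoc _]] := @cone_iso (op_extriangulated C) D B A A' y x x' cxy cx'y.
by apply: subcat_iso PA'; exists c; exact: (iffRL (op_is_iso _)).
Qed.

Lemma right_perp_ext (P : C -> Prop) A B D (x : hom A B) (y : hom B D) :
  conflation x y -> right_perp P A -> right_perp P D -> right_perp P B.
Proof.
move=> [d r] pA pD T PT e.
have [|e' ->] := ext_ker_push_defl r (e := e); first exact: pD.
by rewrite (pA T PT e') raddf0.
Qed.

Lemma left_perp_ext (P : C -> Prop) A B D (x : hom A B) (y : hom B D) :
  conflation x y -> left_perp P A -> left_perp P D -> left_perp P B.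
Proof.
move=> [d r] pA pD T PT e.
have [|e' ->] := ext_ker_pull_infl r (e := e); first exact: pA.
by rewrite (pD T PT e') raddf0.
Qed.

Lemma realizes0_section A B D (x : hom A B) (y : hom B D) :
  realizes (0 : @ext C C D A) x y -> is_section x.
Proof.
by move=> r; have [|s e] := factor_of_push0 r (a := idm A);
  [rewrite raddf0 | exists s].
Qed.

Lemma realizes0_retraction A B D (x : hom A B) (y : hom B D) :
  realizes (0 : @ext C C D A) x y -> is_retraction y.
Proof.
by move=> r; have [|s e] := lift_of_pull0 r (c := idm D);
  [rewrite raddf0 | exists s].
Qed.

(** For an object of either perpendicular class the matching approximation sequence splits, so the
    object is a retract of its approximation. *)
Lemma cotorsion_of_complete :
  (forall A Z, X A -> Y Z -> forall d : @ext C C A Z, d = 0) ->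
  complete_pair X Y -> cotorsion_pair X Y.
Proof.
move=> orth compl; split=> Z; split=> [pZ|? A ? d]; try exact: orth.
  have [_ [Y1 [X1 [i [p [[d r] XX1 YY1]]]]]] := compl Z.
  rewrite (pZ _ XX1 d) in r; have [s si] := realizes0_section r.
  exact: subcat_retract si YY1.
have [[Y0 [X0 [i [p [[d r] XX0 YY0]]]]] _] := compl Z.
rewrite (pZ _ YY0 d) in r; have [s ps] := realizes0_retraction r.
exact: subcat_retract ps XX0.
Qed.

Lemma weq_from_zero A V (t : hom V A) :
  om V -> cocone_in Y t -> Weq_omega X Y (0 : hom zero_obj A).
Proof.
move=> omV [K [k [ck YK]]]; exists V, t.
have : conflation (in2 zero_obj V ∘ k) (t ∘ pr2 zero_obj V).
  apply: conflation_isoM ck; first exact: pr2_in2.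
  apply: copair_ext; first by rewrite [LHS]hom_from_zero [RHS]hom_from_zero.
  by rewrite -compA pr2_in2 compm1 comp1m.
have -> : copair (0 : hom zero_obj A) t = t ∘ pr2 zero_obj V.
  by rewrite /copair comp0m add0r.
by move=> c; split=> //; exists K, (in2 zero_obj V ∘ k).
Qed.

Hypothesis ms :
  is_model_structure (CoFib_omega X) (Fib_omega X Y) (Weq_omega X Y).

(* The morphism from an object of [Y] to zero is a trivial fibration, so it has
   the right lifting property against the inflation of any conflation
   representing [d]. *)
Lemma orth_of_model A Z : X A -> Y Z -> forall d : @ext C C A Z, d = 0.
Proof.
move=> XA YZ d; have [M [x [y r]]] := realizes_ex d.
have [|||h [hx _]] := ms_lift_cofib ms (i := x) (p := 0 : hom Z zero_obj)
  (u := idm Z) (v := 0).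
- by split; [exists A, y; exists d | exists A, y; split=> //; exists d].
- by split; [exact: fibrant_omega | apply: weq_deflation; exact: trivial_of_Y].
- by rewrite [LHS]hom_to_zero [RHS]hom_to_zero.
by rewrite -[d]push1 -hx pushM (realizes_push0 r) raddf0.
Qed.

Lemma trivialP A : complete_pair X Y ->
  trivial_obj (Weq_omega X Y) A <-> Y A.
Proof.
move=> compl; have [cotY _] := cotorsion_of_complete orth_of_model compl.
split=> [wA|YA]; last first.
  (* As an extension of objects of [Y], [X0] lies in [omega], and [p] itself witnesses the weak
     equivalence. *)
  have [[Y0 [X0 [i [p [c XX0 YY0]]]]] _] := compl A.
  apply: (weq_from_zero (t := p)); last by exists Y0, i.
  split=> //; apply/cotY; apply: (right_perp_ext c); exact/cotY.
apply: (cocone_inP (conflation_id_zero A)).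
apply: (fib_cocone wic (X := X)); first exact: fibrant_omega.
(* The composite through [A] is the identity of zero, so [A -> 0] is a weak equivalence; being a
   fibration too, it has its cocone [A] in [Y]. *)
have [_ + _] := ms_two_out_of_three ms (0 : hom zero_obj A) (0 : hom A zero_obj).
apply=> //; apply: weq_deflation.
rewrite (_ : 0 ∘ 0 = idm zero_obj); last by rewrite [RHS]hom_to_zero comp0m.
exists zero_obj, 0; split; [exact: conflation_zero_id | exact: subcat_zero].
Qed.

Lemma complete_of_model : complete_pair X Y.
Proof.
move=> A; split.
  have [D [i [p [ci tp _]]]] := ms_factor_tfib ms (0 : hom zero_obj A).
  rewrite (hom_from_zero i) in ci; have XD := iffLR (cofibrantP X D) ci.
  have [_ [K [k [ck YK]]]] := iffLR (tfibP wic orth_of_model p) tp.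
  by exists K, D, k, p.
have [D [i [p [[_ [X1 [q [cq XX1]]]] tp _]]]] := ms_factor_tfib ms (0 : hom A zero_obj).
have [_ cp] := iffLR (tfibP wic orth_of_model p) tp.
rewrite (hom_to_zero p) in cp.
by exists D, X1, i, q; split=> //; exact: cocone_inP (conflation_id_zero D) cp.
Qed.

Lemma contravariantly_finite_of_model : contravariantly_finite om.
Proof.
move=> A; have [D [i [p [ti fp _]]]] := ms_factor_tcofib ms (0 : hom zero_obj A).
have [_ ci] := iffLR (tcofibP wic orth_of_model i) ti.
exists D, p; split.
  by rewrite (hom_from_zero i) in ci; exact: cone_inP (conflation_zero_id D) ci.
by move=> V s omV; have [u us] := fp V omV s; exists u.
Qed.

(** For [Y], two-out-of-three is applied to [0 -> B -> D]. For [X], it is shown that the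
    [X]-approximation of [A] splits. *)
Lemma hereditary_of_model : hereditary_pair X Y.
Proof.
have orth := orth_of_model; have compl := complete_of_model.
have [cotY _] := cotorsion_of_complete orth compl.
have Ycone A B D (x : hom A B) (y : hom B D) :
    conflation x y -> Y A -> Y B -> Y D.
  move=> c YA YB; apply/(trivialP D compl).
  have [+ _ _] := ms_two_out_of_three ms (0 : hom zero_obj B) y.
  rewrite compm0; apply; first exact/(trivialP B compl).
  by apply: weq_deflation; exists A, x.
move=> A B D x y c; split; last exact: Ycone c.
move=> XB XD; have [d0 r0] := c.
have [[YA [XA [k [p [[d r] XXA YYA]]]]] _] := compl A.
have [_ [I [X2 [i [i' [[d' r'] XX2 YI]]]]]] := compl XA.
(* The class [d] of the approximation is pulled back along [u] from the class of [YA -> I -> V],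
   where [V] is in [Y] by the first half. Hence [u] extends along [x] to [B], and [d] factors
   through E(B, YA) = 0. *)
have [V [u [e [h [d'' [_ r'' _ ud _]]]]]] := ET4 r r'.
have YV : Y V by apply: Ycone YYA YI; exists d''; exact: r''.
have [|v uv] := factor_of_push0 r0 (a := u); first exact: orth.
have d0' : d = 0 by rewrite -ud uv pullM (orth _ _ XB YYA (pull v d'')) raddf0.
rewrite d0' in r; have [s ps] := realizes0_retraction r.
exact: subcat_retract ps XXA.
Qed.

End ModelToCotorsion.

(** * Localization *)

Section LocalizationFunctor.
Variables (C : category) (W : morphism_class C).
Notation LC := (localization W).
Implicit Types A B D : C.

Definition loc_of A B (f : hom A B) : @hom LC A B :=
  loc_class (zfwd (znil W A) f).

Lemma loc_of1 A : loc_of (idm A) = @idm LC A.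
Proof. by apply/loc_classP; exact: zeq_id. Qed.

Lemma loc_ofM A B D (g : hom B D) (f : hom A B) :
  loc_of (g ∘ f) = loc_of g ∘ loc_of f.
Proof.
by rewrite /= loc_compE; apply/loc_classP/zeq_sym; exact: zeq_comp.
Qed.

Definition loc_inv A B (w : hom A B) (Ww : W w) : @hom LC B A :=
  loc_class (zbwd (znil W B) Ww).

Lemma loc_invK A B (w : hom A B) (Ww : W w) :
  loc_of w ∘ loc_inv Ww = @idm LC B.
Proof. by rewrite /= loc_compE; apply/loc_classP; exact: zeq_bf. Qed.

Lemma loc_ofK A B (w : hom A B) (Ww : W w) :
  loc_inv Ww ∘ loc_of w = @idm LC A.
Proof. by rewrite /= loc_compE; apply/loc_classP; exact: zeq_fb. Qed.

Lemma loc_of_iso A B (w : hom A B) : W w -> is_iso (loc_of w).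
Proof. by move=> Ww; exists (loc_inv Ww); rewrite loc_ofK loc_invK. Qed.

Lemma loc_class_fwd A B D (p : zigzag W A B) (f : hom B D) :
  loc_class (zfwd p f) = loc_of f ∘ (loc_class p : @hom LC A B).
Proof. by rewrite /= loc_compE. Qed.

Lemma loc_class_bwd A B D (p : zigzag W A B) (w : hom D B) (Ww : W w) :
  loc_class (zbwd p Ww) = loc_inv Ww ∘ (loc_class p : @hom LC A B).
Proof. by rewrite /= loc_compE. Qed.

End LocalizationFunctor.

(** * From cotorsion pairs to model structures *)

Section CotorsionToModel.
Variables (C : extriangulated_category) (wic : weakly_idempotent_complete C).
Variables X Y : add_subcategory C.
Notation om := (omega X Y).
Implicit Types A B D : C.
Hypothesis cot : cotorsion_pair X Y.
Hypothesis compl : complete_pair X Y.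
Hypothesis her : hereditary_pair X Y.
Hypothesis cfin : contravariantly_finite om.

(** * Bijections modulo [omega] *)

Lemma orth_of_cotorsion A Z : X A -> Y Z -> forall d : @ext C C A Z, d = 0.
Proof. by move=> XA /cot.1; exact. Qed.
Let orth := orth_of_cotorsion.

(** The morphism extends to the [Y]-envelope of [A], which lies in [omega] as an extension of
    objects of [X]. *)
Lemma factors_X_Y A Z (f : hom A Z) : X A -> Y Z -> factors_through om f.
Proof.
move=> XA YZ; have [_ [Y1 [X1 [i [p [[d r] XX1 YY1]]]]]] := compl A.
have [|s ->] := factor_of_push0 r (a := f); first exact: orth.
exists Y1, i, s; split=> //; split=> //; apply/cot.2.
by apply: (@left_perp_ext _ Y _ _ _ i p); [exists d | exact/cot.2 | exact/cot.2].
Qed.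

(** The induced maps on morphism groups modulo [omega] are additive, so injectivity is stated as
    triviality of the kernel. *)
Definition stable_bijective A B (f : hom A B) : Prop :=
  forall T, X T ->
    (forall g : hom T B, exists a : hom T A, factors_through om (g - f ∘ a)) /\
    (forall a : hom T A, factors_through om (f ∘ a) -> factors_through om a).

Lemma factors_congr A B (f g : hom A B) :
  factors_through om (f - g) -> factors_through om g -> factors_through om f.
Proof. by move=> h1 h2; rewrite -[f](subrK g); exact: factors_throughD. Qed.

Lemma factors_in A B V (f : hom A V) (g : hom V B) : om V ->
  factors_through om (g ∘ f).
Proof. by move=> omV; exists V, f, g. Qed.

Lemma stable_bijective_of_weq A B (f : hom A B) :
  Weq_omega X Y f -> stable_bijective f.
Proof.
move=> [V [t [omV _ [Y0 [k [[e r] YY0]]]]]] T XT; split=> [g | a [V' [u [v [omV' fa]]]]].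
  have [|s gs] := lift_of_pull0 r (c := g); first exact: orth.
  exists (pr1 A V ∘ s); rewrite gs /copair compDm -!compA addrC addKr.
  exact: factors_in.
(* Modulo [omega], [in1 ∘ a] equals [in1 ∘ a - s ∘ u], which comes from a morphism of [T] into the
   cocone in [Y]. *)
have [|s vs] := lift_of_pull0 r (c := v); first by apply: orth => //; case: omV'.
have [|z az] := lift_ker r (t := in1 A V ∘ a - s ∘ u).
  by rewrite compmD compmN !compA copair_in1 -vs fa subrr.
have -> : a = pr1 A V ∘ s ∘ u + pr1 A V ∘ k ∘ z.
  by rewrite -!compA -az compmD compmN (compA _ (in1 A V)) pr1_in1 comp1m subrKC.
apply: factors_throughD; first exact: factors_in.
by apply: factors_through_compl; exact: factors_X_Y.
Qed.

Lemma stable_bijective_comp A B D (f : hom A B) (g : hom B D) :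
  stable_bijective f -> stable_bijective g -> stable_bijective (g ∘ f).
Proof.
move=> bf bg T XT; have [sf jf] := bf T XT; have [sg jg] := bg T XT.
split=> [z | a]; last by rewrite -compA => /jg /jf.
have [b zb] := sg z; have [a ba] := sf b; exists a.
have -> : z - g ∘ f ∘ a = (z - g ∘ b) + g ∘ (b - f ∘ a).
  by rewrite compmD compmN compA subrKA.
by apply: factors_throughD => //; exact: factors_through_compl.
Qed.

Lemma stable_bijective_cancelr A B D (f : hom A B) (g : hom B D) :
  stable_bijective f -> stable_bijective (g ∘ f) -> stable_bijective g.
Proof.
move=> bf bh T XT; have [sf jf] := bf T XT; have [sh jh] := bh T XT.
split=> [z | b gb].
  by have [a za] := sh z; exists (f ∘ a); rewrite compA.
have [a ba] := sf b; apply: (factors_congr ba).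
apply: factors_through_compl; apply: jh; apply: (@factors_congr _ _ _ (g ∘ b)) => //.
have := factors_throughN (factors_through_compl g ba).
by rewrite compmD compmN compA opprB.
Qed.

Lemma stable_bijective_cancell A B D (f : hom A B) (g : hom B D) :
  stable_bijective g -> stable_bijective (g ∘ f) -> stable_bijective f.
Proof.
move=> bg bh T XT; have [sg jg] := bg T XT; have [sh jh] := bh T XT.
split=> [b | a fa].
  have [a ba] := sh (g ∘ b); exists a; apply: jg.
  by rewrite compmD compmN compA.
by apply: jh; rewrite -compA; exact: factors_through_compl.
Qed.

Lemma stable_bijective_retract A B A' B' (f : hom A B) (g : hom A' B') :
  is_retract f g -> stable_bijective g -> stable_bijective f.
Proof.
move=> [i [r [j [s [ri sj gi fr]]]]] bg T XT; have [sg jg] := bg T XT.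
split=> [b | a fa].
  have [a ba] := sg (j ∘ b); exists (r ∘ a).
  have := factors_through_compl s ba.
  by rewrite compmD compmN !compA sj comp1m -fr.
rewrite -[a]comp1m -ri -compA; apply: factors_through_compl; apply: jg.
by rewrite compA gi -compA; exact: factors_through_compl.
Qed.

Lemma stable_bijective_in1 A V : om V -> stable_bijective (in1 A V).
Proof.
move=> omV; apply: stable_bijective_of_weq; apply: weq_splitting => //.
  split; first by exists V, (pr2 A V); exact: conflation_in1_pr2.
  by exists (pr1 A V); exact: pr1_in1.
by exists V, (pr2 A V); split=> //; exact: conflation_in1_pr2.
Qed.

(** A lift exists modulo [omega]; the fibration property lifts the error term as well. *)
Lemma fib_lift_X A B T (f : hom A B) (g : hom T B) :
  Fib_omega X Y f -> stable_bijective f -> X T -> exists a : hom T A, g = f ∘ a.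
Proof.
move=> fibf bf XT; have [a [V [u [v [omV e]]]]] := (bf T XT).1 g.
have [w fw] := fibf V omV v.
by exists (w ∘ u + a); rewrite compmD compA fw -e subrK.
Qed.

Lemma cocone_of_stable_bijective A B (f : hom A B) :
  Fib_omega X Y f -> stable_bijective f -> cocone_in Y f.
Proof.
move=> fibf bf.
have lift T (g : hom T B) (XT : X T) := fib_lift_X g fibf bf XT.
have [K [i [d r]]] : deflation f.
  have [[Y0 [X0 [k [p [cp XX0 _]]]]] _] := compl B.
  have [a pa] := lift _ p XX0; apply: (deflation_cancel wic (f := a)).
  by rewrite -pa; exists Y0, k.
exists K, i; split; first by exists d.
apply/cot.1 => X0 XX0 e.
(* A class killed by [i] is a pullback of [d] along some [X0 -> B], which lifts through [f]. *)
have inj (e' : @ext C C X0 K) : push i e' = 0 -> e' = 0.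
  move=> /(ext_ker_push r) [c ->]; have [a ->] := lift _ c XX0.
  by rewrite pullM (realizes_pull0 r) raddf0.
apply: inj; have [M [x [y re]]] := realizes_ex e.
have [[YM [XM [k [p [[dp rp] XXM YYM]]]]] _] := compl M.
(* This gives [e = push q e'], with [e'] the class of [X' -> XM -> X0]; the goal becomes to extend
   [i ∘ q] along [j]. *)
have [X' [q [_ [j [e' [_ rX' _ qe _]]]]]] := ET4op re rp.
have XX' : X X' by apply: (her _).1 XXM XX0; exists e'; exact: rX'.
have [|V [u [v [omV iq]]]] := (bf X' XX').2 (i ∘ q).
  by rewrite compA (realizes_comp0 r) comp0m; exact: factors_through0.
have [|w uw] := factor_of_push0 rX' (a := u); first by apply: orth => //; case: omV.
by rewrite -qe -pushM iq uw pushM pushM (realizes_push0 rX') !raddf0.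
Qed.

Lemma approximation_fib A B V (f : hom A B) (t : hom V B) :
  (forall V' (s : hom V' B), om V' -> exists u : hom V' V, s = t ∘ u) ->
  Fib_omega X Y (copair f t).
Proof.
move=> tapp V' omV' s; have [u su] := tapp V' s omV'.
by exists (in2 A V ∘ u); rewrite compA copair_in2.
Qed.

Lemma weqP A B (f : hom A B) : Weq_omega X Y f <-> stable_bijective f.
Proof.
split=> [|bf]; first exact: stable_bijective_of_weq.
have [V [t [omV tapp]]] := cfin B; exists V, t.
have cf : cocone_in Y (copair f t).
  apply: cocone_of_stable_bijective; first exact: approximation_fib.
  apply: (stable_bijective_cancelr (stable_bijective_in1 A omV)).
  by rewrite copair_in1.
by split=> //; case: cf => K [k [ck _]]; exists K, k.
Qed.

(** * Factorizations, retracts and lifting *)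

Lemma pull0m A D D' (d : @ext C C D A) : pull (0 : hom D' D) d = 0.
Proof. by apply: (addrI (pull 0 d)); rewrite -pull_add !addr0. Qed.

(* The two E-triangles starting in [K] are glued into a single one ending in
   the biproduct; its projections to the two summands yield the required
   deflation and inflation. *)
Lemma pushout_conflation K P B Y1 X1 (k : hom K P) (p : hom P B)
    (j : hom K Y1) (j' : hom Y1 X1) :
  conflation k p -> conflation j j' ->
  exists (M Y2 P2 : C) (i : hom Y2 M) (q : hom M B) (b : hom P P2)
    (h : hom P2 M) (c : hom M X1),
    [/\ isomorphic Y1 Y2, is_iso b, conflation i q, conflation h c
      & q ∘ (h ∘ b) = p].
Proof.
move=> [d1 r1] [d2 r2]; pose mu := pull (pr1 B X1) d1 + pull (pr2 B X1) d2.
have [M [m [n r]]] := realizes_ex mu.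
have [Y2 [u [e [i [d [_ ri]]]]]] := ET4op (realizes0_in2_pr1 B X1) r.
rewrite raddfD /= -!pullM pr1_in2 pr2_in2 pull0m pull1 add0r => re _ _.
have [P2 [u2 [e2 [h [d3 [[nh _] rh]]]]]] := ET4op (ET2_zero B X1) r.
rewrite raddfD /= -!pullM pr1_in1 pr2_in1 pull0m pull1 addr0 => re2 _ _.
have [a [isoa _ _]] := iffLR (realizes_class _ _ r2) re.
have [b [isob _ ub]] := iffLR (realizes_class _ _ r1) re2.
exists M, Y2, P2, i, (pr1 B X1 ∘ n), b, h, (pr2 B X1 ∘ n); split=> //.
- by exists a.
- by exists d.
- by exists d3.
by rewrite compA -(compA (pr1 _ _)) nh compA pr1_in1 comp1m.
Qed.

(** Add an [X]-approximation of [B] to obtain a deflation from [A ⊕ X0], then enlarge its cocone [K]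
    to an object of [Y]. The cone of the resulting inflation from [A] is an extension of [X1] by
    [X0], hence in [X]. *)
Lemma factor_tfib :
  factorizes (CoFib_omega X) (meet_class (Fib_omega X Y) (Weq_omega X Y)).
Proof.
move=> A B f.
have [[Y0 [X0 [k0 [p [cp XX0 _]]]]] _] := compl B.
have [K [k ck]] : deflation (copair f p).
  apply: (deflation_cancel wic (f := in2 A X0)).
  by rewrite copair_in2; exists Y0, k0.
have [_ [Y1 [X1 [j [j' [cj XX1 YY1]]]]]] := compl K.
have [M [Y2 [P2 [i [q [b [h [c [isoY [b' [b'b bb']] ci [dh rh] qh]]]]]]]]] :=
  pushout_conflation ck cj.
have [da ra] := conflation_isoM b'b bb' (conflation_in1_pr2 A X0).
have [G [u [e [g [d'' [_ rg ru _ _]]]]]] := ET4 ra rh.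
have XG : X G.
  apply/cot.2; apply: (@left_perp_ext _ Y _ _ _ u e); last exact/cot.2.
    by eexists; exact: ru.
  exact/cot.2.
exists M, (h ∘ (b ∘ in1 A X0)), q; split.
- by split; exists G, g; [exists d'' | split=> //; exists d''].
- apply: (iffRL (tfibP wic orth q)); split; first by exists Y2, i.
  by exists Y2, i; split=> //; exact: subcat_iso isoY YY1.
by rewrite (compA h) compA qh copair_in1.
Qed.

Lemma factor_tcofib :
  factorizes (meet_class (CoFib_omega X) (Weq_omega X Y)) (Fib_omega X Y).
Proof.
move=> A B f; have [V [t [omV tapp]]] := cfin B.
have c := conflation_in1_pr2 A V.
exists (A ⊕ V), (in1 A V), (copair f t); split; last by rewrite copair_in1.
  apply: (iffRL (tcofibP wic orth _)); split; last by exists V, (pr2 A V).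
  split; first by exists V, (pr2 A V).
  by exists (pr1 A V); exact: pr1_in1.
exact: approximation_fib.
Qed.

(** Factor [f = p ∘ c] with [p] a trivial fibration. Lifting [g] against [p] gives a section [h ∘ j]
    of [p] carrying [f] to [c]: so [f] is an inflation by cancellation, and its cone is a retract of
    that of [c]. *)
Lemma cofib_retract : closed_under_retracts (CoFib_omega X).
Proof.
move=> A B A' B' f g [i [r [j [s [ri sj gi fr]]]]] [_ Xg].
have [D [c [p [[_ Xc] tp fpc]]]] := factor_tfib f.
have [_ Yp] := iffLR (tfibP wic orth p) tp.
have [|h [hg ph]] := cofib_lift orth (u := c ∘ r) (v := s) Xg Yp.
  by rewrite compA -fpc fr.
have hjf : h ∘ j ∘ f = c by rewrite -compA -gi compA hg -compA ri compm1.
have phj : p ∘ (h ∘ j) = idm B by rewrite compA ph sj.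
have [E [y [[d' r'] XE]]] := Xc.
have [F [z [d rz]]] : inflation f.
  by apply: (inflation_cancel wic (g := h ∘ j)); rewrite hjf; exists E, y, d'.
have [a [a' a'a]] := cone_retract rz r' hjf (esym fpc) phj.
split; first by exists F, z, d.
by exists F, z; split; [exists d | exact: subcat_retract a'a XE].
Qed.

Lemma fib_retract : closed_under_retracts (Fib_omega X Y).
Proof.
move=> A B A' B' f g [i [r [j [s [ri sj gi fr]]]]] fg V omV v.
have [u gu] := fg V omV (j ∘ v).
by exists (r ∘ u); rewrite compA fr -compA gu compA sj comp1m.
Qed.

Lemma tcofib_lift : lifts (meet_class (CoFib_omega X) (Weq_omega X Y))
  (Fib_omega X Y).
Proof.
move=> A B D E i p u v ti fp pu.
have [si ci] := iffLR (tcofibP wic orth i) ti.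
have [K [k [r [q [omK ri qi sum _]]]]] := splitting_complement wic si ci.
(* On the image of [A] the lift is prescribed by [u]; on the complement [K] in [omega] it is
   supplied by the fibration. *)
have [w pw] := fp K omK (v ∘ k).
exists (u ∘ r + w ∘ q); split.
  by rewrite compDm -!compA ri qi compm1 compm0 addr0.
by rewrite compmD !compA pu pw -!compA -compmD sum compm1.
Qed.

Theorem model_of_cotorsion :
  is_model_structure (CoFib_omega X) (Fib_omega X Y) (Weq_omega X Y).
Proof.
split.
- move=> A B D f g; split=> /weqP h1 /weqP h2; apply/weqP.
  + exact: stable_bijective_comp h1 h2.
  + exact: stable_bijective_cancelr h1 h2.
  + exact: stable_bijective_cancell h1 h2.
- exact: cofib_retract.
- exact: fib_retract.
- by move=> A B A' B' f g fg /weqP h; apply/weqP; exact: stable_bijective_retract h.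
- move=> A B D E i p u v [_ Xi] tp pu.
  have [_ Yp] := iffLR (tfibP wic orth p) tp; exact: (cofib_lift orth Xi Yp pu).
- exact: tcofib_lift.
- exact: factor_tcofib.
- exact: factor_tfib.
Qed.

(** * The homotopy category *)

Arguments comp : simpl never.
Notation LC := (localization (Weq_omega X Y)).
Notation QC := (quotient_category X om).

Definition quo_of (P Q : quo_obj X) (f : hom (sval P) (sval Q)) : @hom QC P Q :=
  @quo_class C X om P Q f.

Lemma quo_ofP (P Q : quo_obj X) (f g : hom (sval P) (sval Q)) :
  factors_through om (f - g) <-> quo_of f = quo_of g.
Proof. exact: (iff_sym (quo_classP _ _ _)). Qed.

Lemma quo_ofM (P Q R : quo_obj X) (g : hom (sval Q) (sval R))
    (f : hom (sval P) (sval Q)) : quo_of (g ∘ f) = quo_of g ∘ quo_of f.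
Proof. exact: (esym (quo_compE _ _ _)). Qed.

Lemma replacement_ex A : exists (P : quo_obj X) (p : hom (sval P) A),
  Weq_omega X Y p.
Proof.
have [[Y0 [X0 [k [p [c XX0 YY0]]]]] _] := compl A.
by exists (exist _ X0 XX0), p; apply: weq_deflation; exists Y0, k.
Qed.

Definition repl A : quo_obj X := projT1 (cid (replacement_ex A)).
Definition repl_map A : hom (sval (repl A)) A :=
  projT1 (cid (projT2 (cid (replacement_ex A)))).

Lemma repl_weq A : Weq_omega X Y (repl_map A).
Proof. exact: (projT2 (cid (projT2 (cid (replacement_ex A))))). Qed.

Let repl_bij A : stable_bijective (repl_map A) :=
  stable_bijective_of_weq (repl_weq A).

(** The square commutes only modulo [omega]; since [repl_map B] is stably bijective, such an [a]
    exists and its class is unique. *)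
Definition represents A B (f : hom A B)
    (a : hom (sval (repl A)) (sval (repl B))) : Prop :=
  factors_through om (f ∘ repl_map A - repl_map B ∘ a).

Lemma represents_ex A B (f : hom A B) : exists a, represents f a.
Proof. exact: (repl_bij B (svalP (repl A))).1. Qed.

Definition repl_hom A B (f : hom A B) : @hom QC (repl A) (repl B) :=
  quo_of (projT1 (cid (represents_ex f))).

Lemma repl_homE A B (f : hom A B) a : represents f a -> repl_hom f = quo_of a.
Proof.
move=> fa; apply/quo_ofP; apply: (repl_bij B (svalP (repl A))).2.
have fb := projT2 (cid (represents_ex f)).
rewrite compmD compmN -(subrKA (f ∘ repl_map A)).
apply: factors_throughD => //.
by rewrite -opprB; exact: factors_throughN.
Qed.

Lemma repl_homP A B (f : hom A B) :
  exists a, represents f a /\ repl_hom f = quo_of a.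
Proof. by have [a fa] := represents_ex f; exists a; split=> //; exact: repl_homE. Qed.

Lemma repl_hom1 A : repl_hom (idm A) = @idm QC (repl A).
Proof.
apply: repl_homE; rewrite /represents comp1m compm1 subrr.
exact: factors_through0.
Qed.

Lemma repl_homM A B D (g : hom B D) (f : hom A B) :
  repl_hom (g ∘ f) = repl_hom g ∘ repl_hom f.
Proof.
have [a [fa ->]] := repl_homP f; have [b [gb ->]] := repl_homP g.
rewrite -quo_ofM; apply: repl_homE; rewrite /represents.
have -> : g ∘ f ∘ repl_map A - repl_map D ∘ (b ∘ a) =
    g ∘ (f ∘ repl_map A - repl_map B ∘ a) + (g ∘ repl_map B - repl_map D ∘ b) ∘ a.
  by rewrite compmD compDm compmN compNm !compA subrKA.
by apply: factors_throughD; [exact: factors_through_compl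
  | exact: factors_through_compr].
Qed.

(** A Yoneda argument: surjectivity at [Q] yields a right inverse [b], and injectivity at [P] shows
    that it is a left inverse too. *)
Lemma quo_of_iso (P Q : quo_obj X) (a : hom (sval P) (sval Q)) :
  stable_bijective a -> is_iso (quo_of a).
Proof.
move=> ba; have [b ab] := (ba _ (svalP Q)).1 (idm (sval Q)).
exists (quo_of b); rewrite -!quo_ofM; split; last by apply/esym/quo_ofP.
apply/quo_ofP; apply: (ba _ (svalP P)).2; rewrite -opprB compmN.
apply: factors_throughN; rewrite compmD compmN compm1 -[X in X - _]comp1m.
by rewrite compA -compNm -compDm; exact: factors_through_compr.
Qed.

Lemma stable_bijective_congr A B (f g : hom A B) :
  factors_through om (f - g) -> stable_bijective f -> stable_bijective g.
Proof.
move=> fg bf T XT; have [sf jf] := bf T XT; split=> [z | a ga].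
  have [a za] := sf z; exists a; rewrite -(subrKA (f ∘ a)) -compNm -compDm.
  by apply: factors_throughD => //; exact: factors_through_compr.
apply: jf; apply: factors_congr ga; rewrite -compNm -compDm.
exact: factors_through_compr.
Qed.

Lemma repl_hom_iso A B (w : hom A B) : Weq_omega X Y w -> is_iso (repl_hom w).
Proof.
move=> /stable_bijective_of_weq bw; have [a [wa ->]] := repl_homP w.
apply: quo_of_iso; apply: (stable_bijective_cancell (repl_bij B)).
exact: stable_bijective_congr wa (stable_bijective_comp (repl_bij A) bw).
Qed.

Definition repl_inv A B (w : hom A B) (Ww : Weq_omega X Y w) :
  @hom QC (repl B) (repl A) := projT1 (cid (repl_hom_iso Ww)).

Lemma repl_invK A B (w : hom A B) (Ww : Weq_omega X Y w) :
  repl_hom w ∘ repl_inv Ww = idm _.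
Proof. exact: (projT2 (cid (repl_hom_iso Ww))).2. Qed.

Lemma repl_homK A B (w : hom A B) (Ww : Weq_omega X Y w) :
  repl_inv Ww ∘ repl_hom w = idm _.
Proof. exact: (projT2 (cid (repl_hom_iso Ww))).1. Qed.

(** * The replacement functor on the localization *)

Fixpoint repl_zigzag A B (p : zigzag (Weq_omega X Y) A B) :
    @hom QC (repl A) (repl B) :=
  match p with
  | znil => idm _
  | zfwd _ _ p' f => repl_hom f ∘ repl_zigzag p'
  | zbwd _ _ p' _ Ww => repl_inv Ww ∘ repl_zigzag p'
  end.

Lemma repl_zigzag_cat A B D (p : zigzag (Weq_omega X Y) A B)
    (q : zigzag (Weq_omega X Y) B D) :
  repl_zigzag (zcat p q) = repl_zigzag q ∘ repl_zigzag p.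
Proof.
by elim: q => [|E F q IH f|E F q IH w Ww]; rewrite [LHS]/= ?IH ?compA ?comp1m.
Qed.

Lemma repl_zigzag_eq A B (p q : zigzag (Weq_omega X Y) A B) :
  zeq p q -> repl_zigzag p = repl_zigzag q.
Proof.
elim=> {B p q} //=.
- by move=> D p q r _ -> _ ->.
- by move=> D E p q f _ ->.
- by move=> D E p q w Ww _ ->.
- by move=> D p; rewrite repl_hom1 comp1m.
- by move=> D E F p f g; rewrite repl_homM compA.
- by move=> D E p w Ww; rewrite compA repl_homK comp1m.
- by move=> D E p w Ww; rewrite compA repl_invK comp1m.
Qed.

Lemma repl_locE A B (p : zigzag (Weq_omega X Y) A B) :
  repl_zigzag (loc_repr (loc_class p)) = repl_zigzag p.
Proof. by apply: repl_zigzag_eq; apply/loc_classP; exact: loc_reprK. Qed.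

Program Definition repl_functor : functor LC QC :=
  @Functor LC QC repl (fun _ _ u => repl_zigzag (loc_repr u)) _ _.
Next Obligation. by move=> A; rewrite [LHS]repl_locE. Qed.
Next Obligation. by move=> A B D v u; rewrite [LHS]repl_locE repl_zigzag_cat. Qed.

(* With [f = g + h k], both [(1, k)] and [(1, 0)] are sections of the weak
   equivalence [pr1], hence equal in the localization. *)
Lemma loc_of_congr A B (f g : hom A B) : factors_through om (f - g) ->
  loc_of (Weq_omega X Y) f = loc_of (Weq_omega X Y) g.
Proof.
move=> [V [k [h [omV e]]]].
have Wpr : Weq_omega X Y (pr1 A V).
  apply: weq_deflation; exists V, (in2 A V); split; last by case: omV.
  exact: conflation_in2_pr1.
have sec : loc_of (Weq_omega X Y) (pair (idm A) k) = loc_of _ (in1 A V).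
  rewrite -[LHS](@comp1m LC) -[RHS](@comp1m LC) -(loc_ofK Wpr) -!compA -!loc_ofM.
  by rewrite pr1_pair pr1_in1.
rewrite -(copair_in1 g h) [RHS]loc_ofM -sec -loc_ofM copair_pair compm1 -e.
by rewrite addrC subrK.
Qed.

Definition incl_hom (P Q : QC) (u : @hom QC P Q) : @hom LC (sval P) (sval Q) :=
  loc_of (Weq_omega X Y) (quo_repr u).

Lemma incl_homE (P Q : quo_obj X) (f : hom (sval P) (sval Q)) :
  incl_hom (quo_of f) = loc_of (Weq_omega X Y) f.
Proof. by apply: loc_of_congr; apply/quo_ofP; exact: quo_reprK. Qed.

Lemma quo_of_surj (P Q : QC) (u : @hom QC P Q) : exists f, u = quo_of f.
Proof. by exists (quo_repr u); exact: (esym (quo_reprK u)). Qed.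

Lemma incl_hom1 (P : QC) : incl_hom (idm P) = @idm LC (sval P).
Proof. by rewrite [LHS]incl_homE loc_of1. Qed.

Lemma incl_homM (P Q R : QC) (v : @hom QC Q R) (u : @hom QC P Q) :
  incl_hom (v ∘ u) = incl_hom v ∘ incl_hom u.
Proof.
have [g ->] := quo_of_surj v; have [f ->] := quo_of_surj u.
by rewrite -quo_ofM !incl_homE loc_ofM.
Qed.

Definition incl_functor : functor QC LC :=
  @Functor QC LC (fun P => sval P) incl_hom incl_hom1 incl_homM.

Lemma repl_map_natural A B (f : hom A B) :
  loc_of _ (repl_map B) ∘ incl_hom (repl_hom f) =
  loc_of _ f ∘ loc_of (Weq_omega X Y) (repl_map A).
Proof.
have [a [fa ->]] := repl_homP f; rewrite incl_homE -!loc_ofM.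
exact/esym/loc_of_congr.
Qed.

(** Insert [repl_hom w ∘ repl_inv Ww] on the right, apply naturality at [w], and cancel [w] against
    its formal inverse. *)
Lemma repl_map_natural_inv A B (w : hom A B) (Ww : Weq_omega X Y w) :
  loc_of _ (repl_map A) ∘ incl_hom (repl_inv Ww) =
  loc_inv Ww ∘ loc_of (Weq_omega X Y) (repl_map B).
Proof.
rewrite -[RHS]compm1 -(incl_hom1 (repl B)) -(repl_invK Ww) incl_homM.
rewrite -compA (compA (loc_of _ (repl_map B))) repl_map_natural !compA.
by rewrite loc_ofK comp1m.
Qed.

Theorem homotopy_category_equivalence : equivalent_categories LC QC.
Proof.
exists repl_functor, incl_functor; split.
  exists (fun A => loc_of (Weq_omega X Y) (repl_map A)); split=> [A|A B u].
    exact: loc_of_iso (repl_weq A).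
  rewrite -(loc_reprK u) [fmap (id_functor _) _]/=.
  (* Naturality is checked along a representing zigzag, one arrow at a time. *)
  rewrite [fmap _ _]/= repl_locE; elim: (loc_repr u) => [|D E p IH f|D E p IH w Ww].
  - by rewrite incl_hom1 compm1 [RHS](@comp1m LC).
  - rewrite incl_homM compA repl_map_natural -compA [X in _ ∘ X = _]IH.
    by rewrite loc_class_fwd compA.
  - rewrite incl_homM compA repl_map_natural_inv -compA [X in _ ∘ X = _]IH.
    by rewrite loc_class_bwd compA.
(* The same replacement maps serve here: between objects of [X] they are already invertible modulo
   [omega]. *)
exists (fun P => quo_of (repl_map (sval P))); split=> [P|P Q u].
  exact: quo_of_iso (repl_bij _).
have [f ->] := quo_of_surj u; rewrite [fmap (id_functor _) _]/=.
rewrite [fmap _ _]/= incl_homE repl_locE /= compm1.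
have [a [fa ->]] := repl_homP f; rewrite -!quo_ofM.
exact/esym/quo_ofP.
Qed.

End CotorsionToModel.

Theorem theorem1p1 (B : extriangulated_category)
    (hB : weakly_idempotent_complete B) (X Y : add_subcategory B) :
  (is_model_structure (CoFib_omega X) (Fib_omega X Y) (Weq_omega X Y) <->
   hereditary_complete_cotorsion_pair X Y /\
   contravariantly_finite (omega X Y)) /\
  (is_model_structure (CoFib_omega X) (Fib_omega X Y) (Weq_omega X Y) ->
   (forall (A A' : B) (f : hom A A'),
      meet_class (CoFib_omega X) (Weq_omega X Y) f <->
      splitting_inflation f /\ cone_in (omega X Y) f) /\
   (forall (A A' : B) (f : hom A A'),
      meet_class (Fib_omega X Y) (Weq_omega X Y) f <->
      deflation f /\ cocone_in Y f) /\
   (forall A : B, cofibrant (CoFib_omega X) A <-> X A) /\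
   (forall A : B, fibrant (Fib_omega X Y) A) /\
   (forall A : B, trivial_obj (Weq_omega X Y) A <-> Y A) /\
   equivalent_categories (localization (Weq_omega X Y))
     (quotient_category X (omega X Y))).
Proof.
have cotorsion ms := cotorsion_of_complete hB (@orth_of_model B X Y ms)
  (complete_of_model hB ms).
split=> [|ms].
  split=> [ms|[[cot compl her] cfin]]; last exact: model_of_cotorsion.
  split; last exact: contravariantly_finite_of_model.
  split; [exact: cotorsion | exact: complete_of_model | exact: hereditary_of_model].
have orth := orth_of_model ms; have compl := complete_of_model hB ms.
split; [by move=> A A' f; exact: tcofibP |].
split; [by move=> A A' f; exact: tfibP |].
split; [by move=> A; exact: cofibrantP |].
split; [by move=> A; exact: fibrant_omega |].
split; [by move=> A; exact: trivialP |].
exact: homotopy_category_equivalence (cotorsion ms) compl.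
Qed.
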